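(* Let $n\ge3$ and $d=\tfrac{n(n-1)}2$. The Killing metric $g_B=(1,\dots,1)_{g_B}$ on the compact Lie group $\mathrm{SO}(n)$, i.e. the point $(1,\dots,1)\in\mathbb R^d_{>0}$, is an asymptotically stable equilibrium point of the dynamical system on $\mathbb R^d_{>0}$ $$x_k'(t)=-\sum_{i,j}(c_{ij}^k)^2+\frac12\sum_{i,j}(c_{ij}^k)^2\,\frac{x_i^2+x_j^2-x_k^2}{x_ix_j}+\frac12\sum_{i,j}\frac{(c_{ij}^k)^2}{x_ix_j},\qquad k=1,\dots,d,$$ which is the generalized Ricci flow for pairs $(g(t),H_B)$ with $g(t)=(x_1(t),\dots,x_d(t))_{g_B}$ a diagonal left-invariant metric.
   Context: $B$ is the Killing form of $\mathfrak{so}(n)$ and $g_B=-B$ is the Killing (bi-invariant) metric. Let $\{e_1,\dots,e_d\}$ be an enumeration of the basis $\{E_{rs}-E_{sr}\}_{1\le r<s\le n}$ of $\mathfrak{so}(n)$, rescaled by a common constant so as to be $g_B$-orthonormal ($E_{rs}$ is the matrix with $1$ in entry $(r,s)$, zero elsewhere). Structural constants: $c_{ij}^k=g_B([e_i,e_j],e_k)$. The diagonal left-invariant metric $g=(x_1,\dots,x_d)_{g_B}$, $x_i>0$, is defined by $g(e_i,e_j)=x_i\delta_{ij}$. The Cartan $3$-form is $H_B(X,Y,Z)=B([X,Y],Z)$. The generalized Ricci flow is $\partial_tg=-2\mathrm{Rc}(g)+\tfrac12H_g^2$, $\partial_tH=-dd_g^*H$, with $H_g^2(X,Y)=\sum_{i,j}H(X,f_i,f_j)H(Y,f_i,f_j)$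 for a $g$-orthonormal frame $\{f_i\}$. Stability. For $x'=f(x)$ with flow $\phi_t$, an equilibrium point $x_0$ (i.e. $f(x_0)=0$) is stable if for all $\varepsilon>0$ there is $\delta>0$ such that $|x-x_0|<\delta$ implies $|\phi_t(x)-x_0|<\varepsilon$ for all $t\ge0$; it is asymptotically stable if it is stable and there is $\delta>0$ such that $\lim_{t\to\infty}\phi_t(x)=x_0$ whenever $|x-x_0|<\delta$. *)

(* Defs.v *)
From HB Require Import structures.
From mathcomp Require Import all_boot all_order all_algebra.
From mathcomp Require Import all_classical all_reals all_analysis.

Set Implicit Arguments.
Unset Strict Implicit.
Unset Printing Implicit Defensive.

Import Order.TTheory GRing.Theory Num.Theory.
Import numFieldNormedType.Exports.

Local Open Scope classical_set_scope.
Local Open Scope ring_scope.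

Section LieAlgebra.
Variables (R : realType) (n : nat).
Implicit Types X Y Z : 'M[R]_n.

Definition lie X Y : 'M[R]_n := X *m Y - Y *m X.

(* Skew-symmetric matrices, as the kernel of X |-> X + X^T. *)
Definition so : {vspace 'M[R]_n} :=
  lker (linfun (fun X : 'M[R]_n => X + X^T)).

Lemma mem_so X : (X \in so) = (X^T == - X).
Proof.
pose h (X : 'M[R]_n) := X + X^T.
have h_lin : linear h.
  by move=> a U V; rewrite /h linearP /= scalerDr addrACA.
pose hL := GRing.isLinear.Build _ _ _ _ h h_lin.
pose H : {linear 'M[R]_n -> 'M[R]_n} := HB.pack h hL.
by rewrite /so memv_ker (lfunE H) /= /h addrC addr_eq0.
Qed.

(* Trace of the restriction to V of an endomorphism h preserving V. *)
Definition trace_on (V : {vspace 'M[R]_n}) (h : 'M[R]_n -> 'M[R]_n) : R :=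
  \sum_(i < \dim V) coord (vbasis V) i (h (vbasis V)`_i).

Definition killing X Y : R := trace_on so (fun Z => lie X (lie Y Z)).

Definition gB X Y : R := - killing X Y.

Definition cartan_form X Y Z : R := killing (lie X Y) Z.

End LieAlgebra.

(* Left-invariant tensors on SO(n) are identified with their values on so(n);
   derivatives of left-invariant functions vanish, so that only the bracket
   terms of the usual formulas remain.  Only the values on arguments in so(n)
   are meaningful, and f is meant to be a g-orthonormal frame. *)
Section LeftInvariantGeometry.
Variables (R : realType) (n d : nat).
Notation mx := 'M[R]_n.
Implicit Types (g : mx -> mx -> R) (H : mx -> mx -> mx -> R).
Implicit Types (f : d.-tuple mx) (X Y Z : mx).

Definition orthonormal_frame g f : Prop :=
  (forall i : 'I_d, f`_i \in so R n) /\
  (forall i j : 'I_d, g f`_i f`_j = (i == j)%:R).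

(* Levi-Civita connection, from the Koszul formula
   2 g(nabla_X Y, Z) = g([X,Y],Z) - g([Y,Z],X) + g([Z,X],Y). *)
Definition nabla g f X Y : mx :=
  \sum_(k < d)
    (2^-1 * (g (lie X Y) f`_k - g (lie Y f`_k) X + g (lie f`_k X) Y)) *: f`_k.

Definition curvature g f X Y Z : mx :=
  nabla g f X (nabla g f Y Z) - nabla g f Y (nabla g f X Z)
  - nabla g f (lie X Y) Z.

Definition ricci g f Y Z : R :=
  \sum_(i < d) g (curvature g f f`_i Y Z) f`_i.

Definition form_square f H X Y : R :=
  \sum_(i < d) \sum_(j < d) H X f`_i f`_j * H Y f`_i f`_j.

(* d_g^* H (X, Y) = - \sum_i (nabla_{f_i} H)(f_i, X, Y) *)
Definition codiff g f H X Y : R :=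
  \sum_(i < d) (H (nabla g f f`_i f`_i) X Y + H f`_i (nabla g f f`_i X) Y
                + H f`_i X (nabla g f f`_i Y)).

Definition ext_deriv (w : mx -> mx -> R) X Y Z : R :=
  - w (lie X Y) Z + w (lie X Z) Y - w (lie Y Z) X.

(* The generalized Ricci flow equations at time t, for curves of left-invariant
   metrics and 3-forms; f is a frame at time t. *)
Definition generalized_ricci_flow_at (g : R -> mx -> mx -> R)
    (H : R -> mx -> mx -> mx -> R) (t : R) f : Prop :=
  (forall X Y, X \in so R n -> Y \in so R n ->
     is_derive t 1 (fun s => g s X Y)
       (- 2 * ricci (g t) f X Y + 2^-1 * form_square f (H t) X Y)) /\
  (forall X Y Z, X \in so R n -> Y \in so R n -> Z \in so R n ->
     is_derive t 1 (fun s => H s X Y Z)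
       (- ext_deriv (codiff (g t) f (H t)) X Y Z)).

End LeftInvariantGeometry.

Section DiagonalMetrics.
Variables (R : realType) (n d : nat).
Implicit Types (e : d.-tuple 'M[R]_n) (x : 'rV[R]_d).

Definition is_standard_basis e : Prop :=
  (exists a : R,
     perm_eq e [seq a *: (delta_mx p.1 p.2 - delta_mx p.2 p.1 : 'M[R]_n)
               | p in [pred q : 'I_n * 'I_n | (q.1 < q.2)%N]]) /\
  (forall i j : 'I_d, gB e`_i e`_j = (i == j)%:R).

Definition struct_const e (i j k : 'I_d) : R := gB (lie e`_i e`_j) e`_k.

(* The bilinear form on the span of e with g(e_i, e_j) = x_i delta_ij. *)
Definition diag_metric e x (X Y : 'M[R]_n) : R :=
  \sum_(i < d) x 0 i * coord e i X * coord e i Y.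

Definition grf_field e x : 'rV[R]_d :=
  \row_k (- (\sum_i \sum_j struct_const e i j k ^+ 2)
    + 2^-1 * (\sum_i \sum_j struct_const e i j k ^+ 2 *
        ((x 0 i ^+ 2 + x 0 j ^+ 2 - x 0 k ^+ 2) / (x 0 i * x 0 j)))
    + 2^-1 * (\sum_i \sum_j struct_const e i j k ^+ 2 / (x 0 i * x 0 j))).

Definition positive_orthant : set 'rV[R]_d := [set x | forall i, 0 < x 0 i].

End DiagonalMetrics.

Section Stability.
Variables (R : realType) (V : normedModType R).
Implicit Types (F : V -> V) (U : set V) (x : V) (u : R -> V).

(* u t = phi_t(x) for t >= 0.  Values of u at negative times are irrelevant:
   they only serve to write the derivative at 0 as a two-sided one, which is no
   restriction since a one-sided solution extends affinely to t < 0. *)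
Definition is_forward_orbit F U x u : Prop :=
  u 0 = x /\ forall t, 0 <= t -> U (u t) /\ is_derive t 1 u (F (u t)).

(* phi_t(x) exists for all t >= 0 and t |-> phi_t(x) satisfies P. *)
Definition forward_flow_satisfies F U x (P : (R -> V) -> Prop) : Prop :=
  (exists u, is_forward_orbit F U x u) /\
  (forall u, is_forward_orbit F U x u -> P u).

Definition equilibrium F U x0 : Prop := U x0 /\ F x0 = 0.

Definition stable F U x0 : Prop :=
  forall eps : R, 0 < eps -> exists2 delta : R, 0 < delta &
    forall x, U x -> `|x - x0| < delta ->
      forward_flow_satisfies F U x
        (fun u => forall t : R, 0 <= t -> `|u t - x0| < eps).

Definition asymptotically_stable F U x0 : Prop :=
  stable F U x0 /\
  exists2 delta : R, 0 < delta &
    forall x, U x -> `|x - x0| < delta ->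
      forward_flow_satisfies F U x (fun u => u t @[t --> +oo] --> x0).

End Stability.

(* Main.v *)
Require Import Defs.
From HB Require Import structures.
From mathcomp Require Import all_boot all_order all_algebra.
From mathcomp Require Import all_classical all_reals all_analysis.
From mathcomp Require Import zify ring lra.
Import Order.TTheory GRing.Theory Num.Theory.
Import numFieldNormedType.Exports.
Set Implicit Arguments.
Unset Strict Implicit.
Unset Printing Implicit Defensive.
Local Open Scope classical_set_scope.
Local Open Scope ring_scope.

(** The Killing form is ad-invariant, so the structure constants [c i j k] are
    totally antisymmetric, and [e i, e j] is a multiple of a single basis vector,
    so [c i j k * c i j l = 0] for [k != l].  These two facts make the Ricci tensor
    and [H ^ 2] of a diagonal metric diagonal and kill [d ^* H], which gives the
    ODE.  As [\sum_(i, j) (c i j k) ^+ 2 = gB (e k) (e k) = 1], the field is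
    [2^-1 * \sum_(i, j) (c i j k) ^+ 2 *
      ((x i - x j) ^+ 2 + 1 - x k ^+ 2) / (x i * x j)],
    whose linearization at (1, ..., 1) is minus the identity; hence the squared
    distance W to that point satisfies W' <= - W near it.  Global solutions come
    from Picard iteration for the field precomposed with the projection onto a
    small cube, which the solutions never leave. *)

(** * Curves in row vectors *)

(** Stability here demands a solution on the whole half-line from every nearby point and a bound on
    every such solution. Existence calls for a field that is Lipschitz on all of R^d, whereas this
    one is singular where a coordinate vanishes: hence the projection. The decay is proved for an
    arbitrary orbit.

    The linearization is minus the identity whatever the structure constants: for fixed k the
    weights [c i j k ^+ 2] are nonnegative of total mass 1, so the k-th component is half an average
    over (i, j). In the averaged term [(x i - x j) ^+ 2] is of second order and [1 - x k ^+ 2]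
    already vanishes at the point, so the denominator does not count to first order; what remains,
    [- 2 * (x k - 1)], does not depend on (i, j).

    On the geometric side, the tensors are traces over an arbitrary orthonormal frame [f], while the
    ODE refers to [e]; a completeness relation for [f] turns each trace into a sum over [e] with
    weights [1 / x l]. The Killing form is never evaluated: its values on [e] are part of
    [is_standard_basis]. *)

Section RowVectors.
Context {R : realType} {d : nat}.
Implicit Types (x y : 'rV[R]_d) (u : R -> 'rV[R]_d).

Lemma row_norm_leP x (c : R) : 0 <= c ->
  (`|x| <= c) <-> (forall i, `|x 0 i| <= c).
Proof.
move=> c0; rewrite [`|x|]/Num.Def.normr/= mx_normrE; split.
  move=> h i; apply: le_trans h.
  exact: (le_bigmax _ (fun ij : 'I_1 * 'I_d => `|x ij.1 ij.2|) (0, i)).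
by move=> h; apply: bigmax_le => // -[i j] _ /=; rewrite (ord1 i).
Qed.

Lemma row_norm_coord x i : `|x 0 i| <= `|x|.
Proof. exact: (@row_norm_leP x `|x| (normr_ge0 _)).1. Qed.

Lemma is_derive_rowP u (t : R) (v : 'rV[R]_d) :
  is_derive t 1 u v <-> forall i, is_derive t 1 (fun s => u s 0 i) (v 0 i).
Proof.
split=> [[du <-] i|h].
  have dui : derivable (fun s => u s 0 i) t 1 by apply: (derivable_mxP u t 1).1.
  by apply: DeriveDef => //; rewrite derive_mx// mxE.
have du : derivable u t 1.
  by apply/derivable_mxP => i j; rewrite (ord1 i); case: (h j).
apply: DeriveDef => //; rewrite derive_mx//; apply/rowP => i.
by rewrite mxE; case: (h i).
Qed.

End RowVectors.

(** * Calculus on the half-line *)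

Section RealCurves.
Context {R : realType}.
Implicit Types (p q h : R -> R).

(** Integrating from -1 makes 0 an interior point, so the derivative at 0 is two-sided, as
    [is_forward_orbit] requires. *)
Lemma antiderivative h : continuous h ->
  exists p, p 0 = 0 /\ forall t : R, -1 < t -> is_derive t 1 p (h t).
Proof.
move=> ch; pose F x := (\int[@lebesgue_measure R]_(t in [set` `[-1, x]]) (h t))%R.
exists (fun x => F x - F 0); split; first by rewrite subrr.
move=> t t1.
have [] := @continuous_FTC1_closed R h (-1) t (t + 1) _ _ t1 _.
- by rewrite ltrDl.
- apply: continuous_compact_integrable; first exact: segment_compact.
  exact: continuous_subspaceT.
- exact: ch.
rewrite -/F => dF dFe.
have dF' : is_derive t 1 F (h t) by rewrite -dFe derive1E; exact: DeriveDef.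
have := is_deriveB dF' (is_derive_cst (F 0) t 1).
by rewrite subr0.
Qed.

Lemma is_derive_continuous {V : normedModType R} (u : R -> V) (t : R) v :
  is_derive t 1 u v -> {for t, continuous u}.
Proof. by move=> [du _]; apply/differentiable_continuous/derivable1_diffP. Qed.

(** The sign is asked for only before [T]: in the trapping argument of [sqdist_decay] it is known
    only up to the first exit time. *)
Lemma derive_ge0_le p (dp : R -> R) :
  (forall t : R, 0 <= t -> is_derive t 1 p (dp t)) ->
  forall T : R, 0 <= T -> (forall t : R, 0 <= t -> t < T -> 0 <= dp t) -> p 0 <= p T.
Proof.
move=> dpP T T0 dp0.
apply: (@ger0_derive1_le_cc R p 0 T) => //; rewrite ?in_itv/= ?lexx ?T0//.
- move=> t; rewrite in_itv/= => /andP[/ltW t0 _].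
  by have [] := dpP t t0.
- move=> t; rewrite in_itv/= => /andP[/ltW t0 tT].
  by rewrite derive1E; have [_ ->] := dpP t t0; exact: dp0.
- apply: derivable_within_continuous => t; rewrite in_itv/= => /andP[t0 _].
  by have [] := dpP t t0.
Qed.

Lemma derive_norm_le p q (dp dq : R -> R) :
  (forall t : R, 0 <= t -> is_derive t 1 p (dp t)) ->
  (forall t : R, 0 <= t -> is_derive t 1 q (dq t)) ->
  (forall t : R, 0 <= t -> `|dp t| <= dq t) ->
  forall t : R, 0 <= t -> `|p t - p 0| <= q t - q 0.
Proof.
move=> dpP dqP pq t t0.
have h1 := @derive_ge0_le (q - p) (fun t => dq t - dp t)
  (fun t t0 => is_deriveB (dqP t t0) (dpP t t0)) t t0.
have h2 := @derive_ge0_le (q + p) (fun t => dq t + dp t)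
  (fun t t0 => is_deriveD (dqP t t0) (dpP t t0)) t t0.
have {}h1 : q 0 - p 0 <= q t - p t.
  apply: h1 => s s0 _; have := pq s s0; rewrite ler_norml => /andP[]; lra.
have {}h2 : q 0 + p 0 <= q t + p t.
  apply: h2 => s s0 _; have := pq s s0; rewrite ler_norml => /andP[]; lra.
by rewrite ler_norml; apply/andP; split; lra.
Qed.

Lemma is_derive_expR_scale (C a t : R) :
  is_derive t 1 (fun s => C * expR (a * s)) (C * (a * expR (a * t))).
Proof.
have h1 : is_derive t 1 (fun s : R => a * s) a.
  have := @is_deriveZ R R R id a t 1 1 _.
  by move=> /(_ (is_derive_id _ _)); rewrite /GRing.scale/= mulr1; apply.
have h2 := @is_derive1_comp R expR (fun s => a * s) t _ _ (is_derive_expR _) h1.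
have h3 := @is_deriveZ R R R (expR \o (fun s => a * s)) C t 1 _ h2.
by apply: (is_derive_eq h3); rewrite /GRing.scale/= (mulrC (expR _)).
Qed.

End RealCurves.

(** * Global solutions of Lipschitz equations *)

(** The intervals of centre [a m] and radius [b m = 2 * K * 2^-1 ^+ m] are nested, because
    [b m - b m.+1] is exactly the allowed step; the limit is the supremum of their left ends. *)
Lemma geometric_limit {R : realType} (a : nat -> R) (K : R) : 0 <= K ->
  (forall m, `|a m.+1 - a m| <= K * 2^-1 ^+ m) ->
  exists l, forall m, `|a m - l| <= 2 * K * 2^-1 ^+ m.
Proof.
move=> K0 ha; pose b m := 2 * K * 2^-1 ^+ m : R.
have b0 m : 0 <= b m by rewrite !mulr_ge0// exprn_ge0// invr_ge0.
have bS m : b m - b m.+1 = K * 2^-1 ^+ m by rewrite /b exprS; field.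
have lo m : a m - b m <= a m.+1 - b m.+1.
  by have := ha m; rewrite -bS ler_norml => /andP[]; lra.
have hi m : a m.+1 + b m.+1 <= a m + b m.
  by have := ha m; rewrite -bS ler_norml => /andP[]; lra.
have {}lo p m : (p <= m)%N -> a p - b p <= a m - b m.
  apply: (homo_leq (f := fun m => a m - b m) (r := fun x y : R => x <= y)) => //.
  exact: le_trans.
have {}hi p m : (p <= m)%N -> a m + b m <= a p + b p.
  apply: (homo_leq (f := fun m => a m + b m) (r := fun x y : R => y <= x)) => //.
  by move=> y x z xy yz; exact: le_trans yz xy.
have lohi p m : a p - b p <= a m + b m.
  apply: (le_trans (lo _ _ (leq_maxl p m))).
  apply: (le_trans _ (hi _ _ (leq_maxr p m))).
  by rewrite lerD2l ge0_cp.
pose S := [set x | exists m, x = a m - b m].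
have supS : has_sup S.
  split; first by exists (a 0%N - b 0%N), 0%N.
  by exists (a 0%N + b 0%N) => _ [m ->].
exists (sup S) => m; rewrite -/(b m) ler_norml; apply/andP; split.
  suff : sup S <= a m + b m by lra.
  by apply: ge_sup; [case: supS|move=> _ [p ->]].
suff : a m - b m <= sup S by lra.
by apply: sup_upper_bound => //; exists m.
Qed.

Section GlobalSolution.
Context {R : realType} {d : nat}.
Variables (G : 'rV[R]_d -> 'rV[R]_d) (L : R).
Hypotheses (L0 : 0 < L) (GL : forall x y, `|G x - G y| <= L * `|x - y|).
Variable x0 : 'rV[R]_d.
Implicit Types u v w : R -> 'rV[R]_d.

Let even_continuous u := continuous (fun s : R => u `|s|).

(* [picard u v]: v is a primitive of s |-> G (u |s|) starting at x0.
   The absolute value makes the integrand continuous across s = 0. *)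
Let picard u v := v 0 = x0 /\
  forall t : R, -1 < t -> is_derive t 1 v (G (u `|t|)).

Lemma lipschitz_continuous : continuous G.
Proof.
move=> x; apply/(@cvgrPdist_lt _ _ _ _ (nbhs_filter x)) => e e0.
apply: ((@nbhs_normP R 'rV[R]_d x _).2).
exists (e / L) => /=; first by rewrite divr_gt0.
move=> y /= xy; apply: (le_lt_trans (GL _ _)).
by rewrite mulrC -ltr_pdivlMr.
Qed.

Lemma picard_exists u : even_continuous u -> exists v, picard u v.
Proof.
move=> cu.
have hi (i : 'I_d) : exists p : R -> R,
    p 0 = 0 /\ forall t : R, -1 < t -> is_derive t 1 p (G (u `|t|) 0 i).
  apply: (@antiderivative R (fun t => G (u `|t|) 0 i)) => t.
  apply: (@continuous_comp _ _ _ (fun t => G (u `|t|)) (fun x : 'rV[R]_d => x 0 i)).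
    by apply: (@continuous_comp _ _ _ (fun t => u `|t|) G);
      [exact: cu|exact: lipschitz_continuous].
  exact: coord_continuous.
have [p hp] := choice hi.
exists (fun t => x0 + \row_i p i t); split.
  by apply/rowP => i; rewrite !mxE (hp i).1 addr0.
move=> t t1; apply/is_derive_rowP => i.
have -> : (fun s => (x0 + \row_j p j s) 0 i) = cst (x0 0 i) + p i.
  by apply/funext => s; rewrite !mxE.
apply: (is_derive_eq (is_deriveD (is_derive_cst (x0 0 i) t 1) ((hp i).2 t t1))).
by rewrite add0r.
Qed.

Lemma picard_continuous u v : picard u v -> even_continuous v.
Proof.
move=> [_ dv] t; apply: (@continuous_comp _ _ _ (fun t : R => `|t|) v).
  exact: norm_continuous.
apply: (is_derive_continuous (dv _ _)).
by rewrite (lt_le_trans _ (normr_ge0 _)).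
Qed.

(** Weight of the Bielecki norm. The primitive of [L * D * weight] is [D / 2 * weight] up to a
    constant, so Picard iteration contracts by 1/2 on the whole half-line at once and no local
    solutions have to be glued. *)
Let weight (t : R) := expR (2 * L * t).

Lemma weight_gt0 (t : R) : 0 < weight t. Proof. exact: expR_gt0. Qed.

Lemma picard_le v w v' w' (D : R) : 0 <= D ->
  v 0 = w 0 ->
  (forall t : R, 0 <= t -> is_derive t 1 v (v' t)) ->
  (forall t : R, 0 <= t -> is_derive t 1 w (w' t)) ->
  (forall t : R, 0 <= t -> `|v' t - w' t| <= L * (D * weight t)) ->
  forall t : R, 0 <= t -> `|v t - w t| <= D / 2 * weight t.
Proof.
move=> D0 vw dv dw vw' t t0.
apply/row_norm_leP; first by rewrite mulr_ge0 ?divr_ge0// ltW// weight_gt0.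
move=> i.
have hi s (s0 : 0 <= s) := is_deriveB ((is_derive_rowP _ _ _).1 (dv s s0) i)
  ((is_derive_rowP _ _ _).1 (dw s s0) i).
have hq s (s0 : 0 <= s) := is_derive_expR_scale (D / 2) (2 * L) s.
have := derive_norm_le hi hq _ t0.
rewrite !fctE !mxE vw subrr subr0 => h.
apply: (le_trans (h _)); last by rewrite gerBl mulr_ge0 ?divr_ge0// ltW// expR_gt0.
move=> s s0; have := row_norm_coord (v' s - w' s) i; rewrite !mxE => h'.
apply: (le_trans h'); apply: (le_trans (vw' s s0)).
rewrite le_eqVlt; apply/orP; left; apply/eqP; rewrite /weight.
by field.
Qed.

Theorem lipschitz_global_solution :
  exists u, u 0 = x0 /\ forall t : R, 0 <= t -> is_derive t 1 u (G (u t)).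
Proof.
(* [T] has to be total to be iterated; on curves that are not continuous its value is junk. *)
have /choice[T hT] : forall u, exists v, even_continuous u -> picard u v.
  move=> u; case: (pselect (even_continuous u)) => [/picard_exists[v uv]|nu].
    by exists v.
  by exists u.
pose u_ m := iter m T (cst x0).
have cu m : even_continuous (u_ m).
  elim: m => [|m IH]; first exact: cst_continuous.
  exact: picard_continuous (hT _ IH).
have u_P m := hT _ (cu m).
have Tpos u v : picard u v ->
    forall t : R, 0 <= t -> is_derive t 1 v (G (u t)).
  move=> [_ h] t t0; rewrite -[X in u X]ger0_norm//.
  by apply: h; rewrite (lt_le_trans _ t0).
(* The first increment has derivative [G x0], so [picard_le] applies with [D = |G x0| / L] and
   halves it. *)
pose C := `|G x0| / L / 2.
have C0 : 0 <= C by rewrite !divr_ge0// ltW.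
have uS m (t : R) : 0 <= t -> `|u_ m.+1 t - u_ m t| <= C * 2^-1 ^+ m * weight t.
  elim: m t => [|m IH] t t0.
    rewrite expr0 mulr1.
    apply: (@picard_le (u_ 1%N) (cst x0) (fun=> G x0) (cst 0) (`|G x0| / L)) => //.
    - by rewrite divr_ge0// ltW.
    - by have [] := u_P 0%N.
    - exact: Tpos (u_P 0%N).
    - move=> s s0; rewrite subr0 mulrA mulrCA divff ?gt_eqF// mulr1.
      rewrite ler_peMr// -[leLHS]expR0 ler_expR !mulr_ge0// ltW//.
  have -> : C * 2^-1 ^+ m.+1 = (C * 2^-1 ^+ m) / 2 by rewrite exprS; field.
  apply: (picard_le _ _ (Tpos _ _ (u_P m.+1)) (Tpos _ _ (u_P m))) => //.
  - by rewrite mulr_ge0// exprn_ge0// invr_ge0.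
  - by have [-> _] := u_P m.+1; have [-> _] := u_P m.
  - by move=> s s0; apply: (le_trans (GL _ _)); rewrite ler_pM2l// IH.
clearbody C.
have /choice[l hl] : forall t : R, exists l, forall m,
    `|u_ m `|t| - l| <= 2 * C * weight `|t| * 2^-1 ^+ m.
  move=> t.
  have /choice[l hl] : forall i, exists l, forall m,
      `|u_ m `|t| 0 i - l| <= 2 * (C * weight `|t|) * 2^-1 ^+ m.
    move=> i; apply: (geometric_limit (a := fun m => u_ m `|t| 0 i)).
      by rewrite mulr_ge0// ltW ?weight_gt0.
    move=> m; have := row_norm_coord (u_ m.+1 `|t| - u_ m `|t|) i; rewrite !mxE => h.
    by rewrite mulrAC; exact: le_trans h (uS _ _ (normr_ge0 _)).
  exists (\row_i l i) => m; apply/row_norm_leP.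
    by rewrite !mulr_ge0// ?exprn_ge0// ?invr_ge0// ltW ?weight_gt0.
  by move=> i; rewrite !mxE -mulrA in hl *; apply: le_trans (hl i m) _; rewrite !mulrA.
pose u (t : R) : 'rV[R]_d := l `|t|.
have hu m (t : R) : 0 <= t -> `|u_ m t - u t| <= 2 * C * weight t * 2^-1 ^+ m.
  by move=> t0; have := hl t m; rewrite /u ger0_norm.
have small (K e : R) : 0 < e -> 0 <= K -> exists m, K * 2^-1 ^+ m < e.
  move=> e0 K0.
  have : K * 2^-1 ^+ m @[m --> \oo] --> K * 0.
    by apply: cvgMr; apply: cvg_expr; rewrite ger0_norm ?invr_ge0// invf_lt1// ltr1n.
  rewrite mulr0 => /cvgrPdist_lt/(_ e e0)[m _ /(_ m (leqnn m))]/=.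
  rewrite sub0r normrN ger0_norm; first by exists m.
  by rewrite mulr_ge0// exprn_ge0// invr_ge0.
(* The convergence is uniform for [|s| <= |t| + 1], with error constant [K]; the usual three-term
   estimate follows. *)
have cu' : even_continuous u.
  move=> t; apply/cvgrPdist_lt => e e0.
  pose K := 2 * C * expR (2 * L * (`|t| + 1)).
  have K0 : 0 <= K by rewrite !mulr_ge0// ltW ?expR_gt0.
  have e3 : 0 < e / 3 by rewrite divr_gt0.
  have [m hm] := small K _ e3 K0.
  have hK (s : R) : `|s| <= `|t| + 1 -> `|u_ m `|s| - u `|s| | < e / 3.
    move=> st; apply: (le_lt_trans _ hm); apply: (le_trans (hu _ _ (normr_ge0 _))).
    rewrite ler_wpM2r ?exprn_ge0 ?invr_ge0// ler_wpM2l ?mulr_ge0//.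
    by rewrite ler_expR ler_wpM2l// mulr_ge0// ltW.
  have /cvgrPdist_lt/(_ _ e3) cum := cu m t.
  near=> s.
  have h1 : `|u_ m `|t| - u `|t| | < e / 3 by apply: hK; rewrite lerDl.
  have h2 : `|u_ m `|s| - u `|s| | < e / 3.
    apply: hK; rewrite -[s](subrK t) addrC (le_trans (ler_normD _ _))// lerD2l.
    by rewrite distrC; near: s; apply: cvgr_dist_le => //; exact: ltr01.
  have h3 : `|u_ m `|t| - u_ m `|s| | < e / 3 by near: s.
  rewrite (_ : u _ - _ = - (u_ m `|t| - u `|t|) + (u_ m `|t| - u_ m `|s|)
     + (u_ m `|s| - u `|s|)); last first.
    by rewrite opprB !subrKA.
  rewrite (le_lt_trans (ler_normD _ _))//.
  have := ler_normD (- (u_ m `|t| - u `|t|)) (u_ m `|t| - u_ m `|s|).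
  by rewrite normrN; lra.
have [v [v0 dv]] : exists v, picard u v by exact: picard_exists.
have dv' := Tpos _ _ (conj v0 dv).
(* The limit is a fixed point: [u_ m.+1] is close to [u] by construction, and close to [v] because
   it is the primitive built from [u_ m] as [v] is from [u]. *)
have vu (t : R) : 0 <= t -> v t = u t.
  move=> t0; apply/eqP; rewrite -subr_eq0 -normr_le0; apply/ler_addgt0Pl => e e0.
  rewrite addr0.
  pose K := 2 * C * weight t.
  have K0 : 0 <= K by rewrite !mulr_ge0// ltW ?weight_gt0.
  have e2 : 0 < e / 2 by rewrite divr_gt0.
  have [m hm] := small K _ e2 K0.
  have h1 : `|u_ m.+1 t - u t| <= K * 2^-1 ^+ m / 2.
    by apply: (le_trans (hu _ _ t0)); rewrite -/K exprS; lra.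
  have h2 : `|v t - u_ m.+1 t| <= (2 * C * 2^-1 ^+ m) / 2 * weight t.
    apply: (picard_le _ _ dv' (Tpos _ _ (u_P m))) => //.
    - by rewrite !mulr_ge0// exprn_ge0// invr_ge0.
    - by rewrite v0; have [-> _] := u_P m.
    - move=> s s0; apply: (le_trans (GL _ _)); rewrite ler_pM2l// distrC.
      by rewrite mulrAC; exact: hu.
  rewrite -(subrKA (u_ m.+1 t)) (le_trans (ler_normD _ _))//.
  have e3 : 2 * C * 2^-1 ^+ m / 2 * weight t = K * 2^-1 ^+ m / 2 by rewrite /K; ring.
  by move: h2; rewrite e3; lra.
(* The witness is [v]: the even curve [u] agrees with it for t >= 0 but in general has no two-sided
   derivative at 0. *)
exists v; split => // t t0; rewrite vu//; exact: dv'.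
Unshelve. all: by end_near. Qed.
End GlobalSolution.

(** * Lyapunov stability *)

Section Lyapunov.
Context {R : realType} {d : nat}.
Variable x0 : 'rV[R]_d.
Implicit Types (x y : 'rV[R]_d) (u : R -> 'rV[R]_d).

(** The norm on row vectors is the maximum norm, which is not differentiable; the Euclidean square
    is, and the next lemmas compare the two. *)
Definition sqdist x : R := \sum_i (x 0 i - x0 0 i) ^+ 2.

Lemma sqdist_ge0 x : 0 <= sqdist x.
Proof. by apply: sumr_ge0 => i _; rewrite sqr_ge0. Qed.

Lemma norm_le_sqdist x (r : R) : 0 <= r -> sqdist x <= r ^+ 2 -> `|x - x0| <= r.
Proof.
move=> r0 hx; apply/row_norm_leP => // i; rewrite !mxE.
rewrite -(@ler_pXn2r _ 2) ?nnegrE// real_normK ?num_real//.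
apply: le_trans hx; rewrite /sqdist (bigD1 i)//= lerDl.
by apply: sumr_ge0 => j _; rewrite sqr_ge0.
Qed.

Lemma sqdist_le_norm x : sqdist x <= d%:R * `|x - x0| ^+ 2.
Proof.
apply: (@le_trans _ _ (\sum_(i < d) `|x - x0| ^+ 2)).
  apply: ler_sum => i _; rewrite -real_normK ?num_real// ler_pXn2r ?nnegrE//.
  by have := row_norm_coord (x - x0) i; rewrite !mxE.
by rewrite sumr_const card_ord mulr_natl.
Qed.

Lemma is_derive_sqdist u v (t : R) : is_derive t 1 u v ->
  is_derive t 1 (sqdist \o u) (2 * \sum_i (u t 0 i - x0 0 i) * v 0 i).
Proof.
move=> /is_derive_rowP du.
have h i : is_derive t 1 (((fun s => u s 0 i) - cst (x0 0 i)) ^+ 2) _ :=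
  is_deriveX 2 (is_deriveB (du i) (is_derive_cst _ _ _)).
have -> : sqdist \o u = \sum_i ((fun s => u s 0 i) - cst (x0 0 i)) ^+ 2.
  by apply/funext => s; rewrite fct_sumE.
apply: (is_derive_eq (is_derive_sum h)).
rewrite mulr_sumr; apply: eq_bigr => i _.
by rewrite subr0 /GRing.scale/= expr1 mulrA.
Qed.

(** The curve cannot leave the sublevel set, and inside it [expR t * sqdist (u t)] is nonincreasing.
    The field [H] is general because it is used both for the clamped field, to build an orbit, and
    for the original one, to bound any orbit. *)
Lemma sqdist_decay (H : 'rV[R]_d -> 'rV[R]_d) (r : R) u :
  (forall x, sqdist x < r -> 2 * \sum_i (x 0 i - x0 0 i) * H x 0 i <= - sqdist x) ->
  (forall t : R, 0 <= t -> is_derive t 1 u (H (u t))) ->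
  sqdist (u 0) < r ->
  forall t : R, 0 <= t -> sqdist (u t) <= sqdist (u 0) * expR (- t).
Proof.
move=> HW du u0r.
have dw (t : R) (t0 : 0 <= t) := is_derive_sqdist (du t t0).
have trap (t : R) : 0 <= t -> sqdist (u t) < r.
  move=> t0; rewrite ltNge; apply/negP => rt.
  (* Up to the first exit time [inf S] the squared distance decreases, so it is still below [r]
     there, and by continuity also shortly after; this contradicts the choice of [inf S]. *)
  pose S := [set s : R | 0 <= s /\ r <= sqdist (u s)].
  have infS : has_inf S.
    by split; [exists t|exists 0 => s []].
  have Ss s : S s -> inf S <= s by move=> ?; apply: ge_inf => //; case: infS.
  have T0 : 0 <= inf S by apply: lb_le_inf; [case: infS|move=> s []].
  have : sqdist (u (inf S)) < r.
    apply: le_lt_trans u0r; rewrite -lerN2.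
    apply: (derive_ge0_le (p := - (sqdist \o u)) (fun t t0 => is_deriveN (dw t t0))) => //.
    move=> s s0 sT; rewrite oppr_ge0.
    apply: (le_trans (HW _ _)); last by rewrite oppr_le0 sqdist_ge0.
    by rewrite ltNge; apply/negP => rs; have := Ss s (conj s0 rs); rewrite leNgt sT.
  move=> uTr.
  have := is_derive_continuous (dw _ T0) => /cvgr_lt/(_ _ uTr)/nbhs_normP[e /= e0 he].
  have [s Ss' se] := inf_adherent e0 infS.
  have := he s; rewrite /= -[`|_ - s|]distrC ger0_norm ?subr_ge0 ?Ss//.
  rewrite ltrBlDl se => /(_ isT); rewrite ltNge.
  by case: Ss' => _ ->.
move=> t t0.
have de (s : R) := is_derive_expR_scale 1 1 s.
have dv (s : R) (s0 : 0 <= s) := is_deriveN (is_deriveM (dw s s0) (de s)).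
suff : - (sqdist (u 0) * (1 * expR (1 * 0))) <= - (sqdist (u t) * (1 * expR (1 * t))).
  by rewrite !mul1r expR0 mulr1 lerN2 expRN ler_pdivlMr ?expR_gt0.
apply: (derive_ge0_le dv t0) => s s0 _.
rewrite /GRing.scale/= !mul1r oppr_ge0 mulrC -mulrDr.
rewrite pmulr_rle0 ?expR_gt0//.
by have := HW _ (trap s s0); lra.
Qed.

Lemma small_norm_sqdist (r : R) : 0 < r -> exists2 delta : R, 0 < delta &
  forall x, `|x - x0| < delta -> sqdist x < r ^+ 2.
Proof.
(* With [d.+1] in place of [d] the bound is strict, since d < (d + 1) ^ 2, and d = 0 is covered. *)
move=> r0; exists (r / d.+1%:R); first by rewrite divr_gt0.
move=> x hx; apply: (le_lt_trans (sqdist_le_norm x)).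
have h : `|x - x0| ^+ 2 <= (r / d.+1%:R) ^+ 2.
  by rewrite ler_pXn2r ?nnegrE ?divr_ge0//; exact: ltW.
apply: (le_lt_trans (ler_wpM2l (ler0n _ _) h)).
rewrite expr_div_n mulrA ltr_pdivrMr ?exprn_gt0// mulrC ltr_pM2l ?exprn_gt0//.
by rewrite expr2 -natrM ltr_nat; lia.
Qed.

(** A closed ball for the maximum norm is a cube, so the retraction onto it acts coordinatewise and
    is 1-Lipschitz for that norm. *)
Definition clamp (r : R) x : 'rV[R]_d :=
  \row_i Num.max (x0 0 i - r) (Num.min (x0 0 i + r) (x 0 i)).

Lemma clamp_id (r : R) x : `|x - x0| <= r -> clamp r x = x.
Proof.
move=> xr; apply/rowP => i; rewrite !mxE.
have := le_trans (row_norm_coord (x - x0) i) xr; rewrite !mxE ler_norml => /andP[h1 h2].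
rewrite min_r ?max_r//; lra.
Qed.

Lemma clamp_ball (r : R) x : 0 <= r -> `|clamp r x - x0| <= r.
Proof.
move=> r0; apply/row_norm_leP => // i; rewrite !mxE ler_norml; apply/andP; split.
  by rewrite lerBrDr addrC le_max lexx.
rewrite lerBlDr ge_max ge_min; apply/andP; split; [lra|apply/orP; left; lra].
Qed.

Lemma clamp_nonexpansive (r : R) x y : `|clamp r x - clamp r y| <= `|x - y|.
Proof.
apply/row_norm_leP => // i; rewrite !mxE.
have := row_norm_coord (x - y) i; rewrite !mxE; apply: le_trans.
have normP (p q : R) : - `|p - q| <= p - q <= `|p - q| by rewrite -ler_norml.
have maxN (c p q : R) : `|Num.max c p - Num.max c q| <= `|p - q|.
  rewrite ler_norml; have /andP[] := normP p q; have : 0 <= `|p - q| by [].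
  by move: `|_| => e; case: (leP c p); case: (leP c q) => *; apply/andP; split; lra.
have minN (c p q : R) : `|Num.min c p - Num.min c q| <= `|p - q|.
  rewrite ler_norml; have /andP[] := normP p q; have : 0 <= `|p - q| by [].
  by move: `|_| => e; case: (leP c p); case: (leP c q) => *; apply/andP; split; lra.
exact: le_trans (maxN _ _ _) (minN _ _ _).
Qed.

Section Stability.
Variables (F : 'rV[R]_d -> 'rV[R]_d) (U : set 'rV[R]_d) (r L : R).
Hypotheses (r0 : 0 < r) (L0 : 0 < L).
Hypothesis UP : forall x, `|x - x0| <= r -> U x.
Hypothesis FL : forall x y, `|x - x0| <= r -> `|y - x0| <= r ->
  `|F x - F y| <= L * `|x - y|.
Hypothesis FW : forall x, `|x - x0| <= r ->
  2 * \sum_i (x 0 i - x0 0 i) * F x 0 i <= - sqdist x.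

Let FW' x : sqdist x < r ^+ 2 ->
  2 * \sum_i (x 0 i - x0 0 i) * F x 0 i <= - sqdist x.
Proof. by move=> xr; apply: FW; apply: norm_le_sqdist; exact: ltW. Qed.

(** The Euclidean ball of radius [r] lies in the cube where [clamp r] is the identity. A solution of
    the clamped equation that starts in this ball stays in it by the decay, so it solves the
    original equation. *)
Lemma forward_orbit_exists x : sqdist x < r ^+ 2 ->
  exists u, is_forward_orbit F U x u.
Proof.
move=> xr.
have GL y z : `|F (clamp r y) - F (clamp r z)| <= L * `|y - z|.
  apply: (le_trans (FL _ _)); try by apply: clamp_ball; exact: ltW.
  by rewrite ler_pM2l// clamp_nonexpansive.
have [u [u0 du]] := lipschitz_global_solution L0 GL x.
have ur (t : R) : 0 <= t -> `|u t - x0| <= r.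
  move=> t0; apply: norm_le_sqdist; first exact: ltW.
  apply: (le_trans (@sqdist_decay (F \o clamp r) (r ^+ 2) u _ du _ t t0)).
  - move=> y yr; rewrite /= clamp_id ?FW'//.
    by apply: norm_le_sqdist; exact: ltW.
  - by rewrite u0.
  - rewrite u0; apply: le_trans (ltW xr).
    by rewrite ler_piMr ?sqdist_ge0// -expR0 ler_expR oppr_le0.
exists u; split => // t t0; split; first by apply: UP; exact: ur.
by have := du t t0; rewrite clamp_id// ur.
Qed.

Lemma forward_orbit_decay x u : sqdist x < r ^+ 2 -> is_forward_orbit F U x u ->
  forall t : R, 0 <= t -> sqdist (u t) <= sqdist x * expR (- t).
Proof.
move=> xr [u0 du] t t0; rewrite -u0; apply: (sqdist_decay FW') => //.
  by move=> s s0; have [] := du s s0.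
by rewrite u0.
Qed.

Theorem lyapunov_asymptotically_stable : asymptotically_stable F U x0.
Proof.
split=> [eps eps0|].
  pose m := Num.min (eps / 2) r.
  have m0 : 0 < m by rewrite lt_min r0 divr_gt0.
  have [delta delta0 hdelta] := small_norm_sqdist m0.
  exists delta => // x _ /hdelta xm.
  have xr : sqdist x < r ^+ 2.
    apply: (lt_le_trans xm); have mr : m <= r by rewrite ge_min lexx orbT.
    by rewrite ler_pXn2r ?nnegrE// ltW.
  split; first exact: forward_orbit_exists.
  move=> u xu t t0.
  apply: (@le_lt_trans _ _ (eps / 2)); last by rewrite ltr_pdivrMr// ltr_pMr// ltr1n.
  apply: (@le_trans _ _ m); last by rewrite ge_min lexx.
  apply: norm_le_sqdist; first exact: ltW.
  apply: (le_trans (forward_orbit_decay xr xu t0)); apply: le_trans (ltW xm).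
  by rewrite ler_piMr ?sqdist_ge0// -expR0 ler_expR oppr_le0.
have [delta delta0 hdelta] := small_norm_sqdist r0.
exists delta => // x _ /hdelta xr.
split; first exact: forward_orbit_exists.
move=> u xu; apply/(@cvgrPdist_le R 'rV[R]_d) => e e0; near=> t.
rewrite distrC; apply: norm_le_sqdist; first exact: ltW.
have t0 : 0 <= t by near: t; exact: nbhs_pinfty_ge.
apply: (le_trans (forward_orbit_decay xr xu t0)).
rewrite expRN ler_pdivrMr ?expR_gt0//.
have e20 : 0 < e ^+ 2 by rewrite exprn_gt0.
(* The bound [1 + t <= expR t] suffices: it is enough that [t] exceeds [sqdist x / e ^+ 2]. *)
apply: (@le_trans _ _ (e ^+ 2 * (1 + t))); last first.
  by rewrite ler_pM2l// expR_ge1Dx.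
rewrite -ler_pdivrMl//; apply: (@le_trans _ _ t); last by rewrite lerDr.
by near: t; apply: nbhs_pinfty_ge; rewrite num_real.
Unshelve. all: by end_near. Qed.

End Stability.

End Lyapunov.

(** * The vector field near (1, ..., 1) *)

Section RationalTerm.
Context {R : realType}.
Implicit Types a b c : R.

Definition flow_term a b c : R := (a ^+ 2 + b ^+ 2 - c ^+ 2) / (a * b) + (a * b)^-1.

Lemma flow_term_linearization a b c (m : R) : m <= 2^-1 ->
  `|a - 1| <= m -> `|b - 1| <= m -> `|c - 1| <= m ->
  `|flow_term a b c - 2 + 2 * (c - 1)| <= 40 * m ^+ 2.
Proof.
move=> m2 ha hb hc; have m0 : 0 <= m := le_trans (normr_ge0 _) ha.
have ab4 : 4^-1 <= a * b.
  by move: ha hb; rewrite !ler_norml => /andP[h1 h2] /andP[h3 h4]; nra.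
have ab0 : a * b != 0 by rewrite gt_eqF//; lra.
have [a0 b0] : a != 0 /\ b != 0 by apply/andP; rewrite -negb_or -mulf_eq0.
pose x := a - 1; pose y := b - 1; pose z := c - 1.
(* Every term of this numerator is quadratic in (x, y, z). It is at most (4 + 1 + 2 * 5 / 2) * m ^ 2
   = 10 * m ^ 2, and the denominator is at least 1/4: hence 40. *)
have -> : flow_term a b c - 2 + 2 * (c - 1) =
    ((x - y) ^+ 2 - z ^+ 2 + 2 * z * (x + y + x * y)) / (a * b).
  by rewrite /flow_term /x /y /z; field; rewrite a0 b0.
rewrite normrM normfV [`|a * b|]gtr0_norm; last by lra.
rewrite ler_pdivrMr; last by lra.
apply: (@le_trans _ _ (10 * m ^+ 2)); last by nra.
rewrite -/x -/y -/z in ha hb hc.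
have h1 : `|x - y| ^+ 2 <= (2 * m) ^+ 2.
  rewrite ler_pXn2r ?nnegrE ?mulr_ge0//.
  by apply: (le_trans (ler_normB _ _)); lra.
have h2 : `|z| ^+ 2 <= m ^+ 2 by rewrite ler_pXn2r ?nnegrE.
have h3 : `|x * y| <= m * m by rewrite normrM ler_pM.
have h4 : `|x + y + x * y| <= 5 / 2 * m.
  apply: (le_trans (ler_normD _ _)); have := ler_normD x y; nra.
have h5 : `|z * (x + y + x * y)| <= m * (5 / 2 * m) by rewrite normrM ler_pM.
apply: (le_trans (ler_normD _ _)).
have := ler_normB ((x - y) ^+ 2) (z ^+ 2); rewrite !normrX.
by rewrite -[2 * z * _]mulrA normrM [`|2|]ger0_norm//; nra.
Qed.

Lemma flow_term_lipschitz a b c a' b' c' (m : R) :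
  `|a - 1| <= 2^-1 -> `|b - 1| <= 2^-1 -> `|c - 1| <= 2^-1 ->
  `|a' - 1| <= 2^-1 -> `|b' - 1| <= 2^-1 -> `|c' - 1| <= 2^-1 ->
  `|a - a'| <= m -> `|b - b'| <= m -> `|c - c'| <= m ->
  `|flow_term a b c - flow_term a' b' c'| <= 700 * m.
Proof.
have bnd (x : R) : `|x - 1| <= 2^-1 -> 2^-1 <= x <= 3 / 2.
  by rewrite ler_norml => /andP[? ?]; apply/andP; split; lra.
move=> /bnd/andP[a1 a2] /bnd/andP[b1 b2] /bnd/andP[c1 c2].
move=> /bnd/andP[a1' a2'] /bnd/andP[b1' b2'] /bnd/andP[c1' c2'] ha hb hc.
have m0 : 0 <= m := le_trans (normr_ge0 _) ha.
have sq (x y : R) : 2^-1 <= x -> x <= 3 / 2 -> 2^-1 <= y -> y <= 3 / 2 ->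
    `|x - y| <= m -> `|x ^+ 2 - y ^+ 2| <= 3 * m.
  move=> x1 x2 y1 y2 xy; rewrite subr_sqr normrM mulrC ler_pM//.
  by rewrite ger0_norm; lra.
have ha2 := sq _ _ a1 a2 a1' a2' ha.
have hb2 := sq _ _ b1 b2 b1' b2' hb.
have hc2 := sq _ _ c1 c2 c1' c2' hc.
pose N := a ^+ 2 + b ^+ 2 - c ^+ 2 + 1; pose N' := a' ^+ 2 + b' ^+ 2 - c' ^+ 2 + 1.
have hN : `|N - N'| <= 9 * m.
  by move: ha2 hb2 hc2; rewrite !ler_norml /N /N' =>
    /andP[? ?] /andP[? ?] /andP[? ?]; apply/andP; split; lra.
have hN6 : `|N| <= 6 by rewrite ler_norml /N; apply/andP; split; nra.
have hP : `|a' * b' - a * b| <= 3 * m.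
  have -> : a' * b' - a * b = - (a * (b - b') + b' * (a - a')) by ring.
  rewrite normrN; apply: (le_trans (ler_normD _ _)); rewrite !normrM.
  rewrite (ger0_norm (_ : 0 <= a)); last lra.
  rewrite (ger0_norm (_ : 0 <= b')); last lra.
  nra.
have P1 : 4^-1 <= a * b by nra.
have P1' : 4^-1 <= a' * b' by nra.
have P2 : a * b <= 9 / 4 by nra.
have -> : flow_term a b c - flow_term a' b' c' =
    (N * (a' * b' - a * b) + (a * b) * (N - N')) / ((a * b) * (a' * b')).
  by rewrite /flow_term /N /N'; field; rewrite !gt_eqF//; lra.
have PP : 16^-1 <= (a * b) * (a' * b') by nra.
rewrite normrM normfV [`|(a * b) * _|]gtr0_norm; last by lra.
rewrite ler_pdivrMr; last by lra.
(* 39 exceeds 6 * 3 + 9 / 4 * 9, and 39 * 16 is below 700. *)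
apply: (@le_trans _ _ (39 * m)); last by nra.
apply: (le_trans (ler_normD _ _)); rewrite !(normrM N) !(normrM (a * b)).
rewrite (ger0_norm (_ : 0 <= a * b)); last lra.
have h1 : `|N| * `|a' * b' - a * b| <= 6 * (3 * m) by rewrite ler_pM.
have h2 : a * b * `|N - N'| <= 9 / 4 * (9 * m) by rewrite ler_pM//; lra.
lra.
Qed.

End RationalTerm.

(** * The field for abstract weights of total mass 1 *)

Section QuadraticFlow.
Context {R : realType} {d : nat}.
Variable A : 'I_d -> 'I_d -> 'I_d -> R.
Hypotheses (A0 : forall i j k, 0 <= A i j k)
  (A1 : forall k, \sum_i \sum_j A i j k = 1).

(** Convertible to [grf_field e] when [A i j k] is [struct_const e i j k ^+ 2]. *)
Definition flow_field (x : 'rV[R]_d) : 'rV[R]_d :=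
  \row_k (- (\sum_i \sum_j A i j k)
    + 2^-1 * (\sum_i \sum_j A i j k *
        ((x 0 i ^+ 2 + x 0 j ^+ 2 - x 0 k ^+ 2) / (x 0 i * x 0 j)))
    + 2^-1 * (\sum_i \sum_j A i j k / (x 0 i * x 0 j))).

Lemma flow_fieldE x k : flow_field x 0 k =
  2^-1 * \sum_i \sum_j A i j k * (flow_term (x 0 i) (x 0 j) (x 0 k) - 2).
Proof.
rewrite mxE -addrA -mulrDr -big_split/=.
have -> : \sum_i \sum_j A i j k = 2^-1 * \sum_i \sum_j A i j k * 2.
  rewrite -[LHS](mulKf (_ : 2 != 0 :> R))// mulr_sumr; congr (_ * _).
  by apply: eq_bigr => i _; rewrite mulr_sumr; apply: eq_bigr => j _; rewrite mulrC.
rewrite -mulrN -mulrDr addrC -sumrB; congr (_ * _).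
apply: eq_bigr => i _; rewrite -big_split -sumrB; apply: eq_bigr => j _ /=.
by rewrite /flow_term; ring.
Qed.

Let avgE k (c : R) : \sum_i \sum_j A i j k * c = c.
Proof.
rewrite -[RHS]mul1r -(A1 k) mulr_suml; apply: eq_bigr => i _.
by rewrite mulr_suml.
Qed.

Let avg_le k (f : 'I_d -> 'I_d -> R) (m : R) :
  (forall i j, `|f i j| <= m) -> `|\sum_i \sum_j A i j k * f i j| <= m.
Proof.
move=> fm; apply: (le_trans (ler_norm_sum _ _ _)).
rewrite -[leRHS](avgE k); apply: ler_sum => i _.
apply: (le_trans (ler_norm_sum _ _ _)); apply: ler_sum => j _.
by rewrite normrM ger0_norm// ler_wpM2l.
Qed.

Let coord_ball (x : 'rV[R]_d) (r : R) i : `|x - const_mx 1| <= r -> `|x 0 i - 1| <= r.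
Proof.
by move=> h; have := row_norm_coord (x - const_mx 1) i; rewrite !mxE => /le_trans; apply.
Qed.

Lemma flow_field_lipschitz x y :
  `|x - const_mx 1| <= 2^-1 -> `|y - const_mx 1| <= 2^-1 ->
  `|flow_field x - flow_field y| <= 350 * `|x - y|.
Proof.
move=> hx hy; apply/row_norm_leP; first exact: mulr_ge0 (ler0n _ 350) (normr_ge0 _).
have hxy l : `|x 0 l - y 0 l| <= `|x - y|.
  by have := row_norm_coord (x - y) l; rewrite !mxE.
move=> k; rewrite !mxE.
have := flow_fieldE x k; have := flow_fieldE y k; rewrite !mxE => -> ->.
rewrite -mulrBr -sumrB normrM ger0_norm ?invr_ge0//.
have -> : 350 * `|x - y| = 2^-1 * (700 * `|x - y|) by field.
rewrite ler_wpM2l ?invr_ge0//.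
under eq_bigr do rewrite -sumrB.
under eq_bigr do under eq_bigr do rewrite -mulrBr opprB addrA subrK.
apply: avg_le => i j; apply: flow_term_lipschitz; (exact: coord_ball || exact: hxy).
Qed.

(** With m the norm and W the squared distance, each component is [- (x k - 1)] up to 20 m^2, so the
    left side is at most -2 W + 40 d m^3. The radius makes 40 d m <= 1, and m^2 <= W absorbs the
    rest into one W. *)
Lemma flow_field_dissipative x : `|x - const_mx 1| <= (40 * d.+1%:R)^-1 ->
  2 * \sum_i (x 0 i - (const_mx 1 : 'rV[R]_d) 0 i) * flow_field x 0 i <=
  - sqdist (const_mx 1) x.
Proof.
set m := `|x - _| => mr.
have d1 : 40 * m * d%:R <= 1.
  have := mr; rewrite -[_^-1]mul1r ler_pdivlMr ?mulr_gt0// => h.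
  apply: le_trans h; rewrite mulrA (mulrC m); apply: ler_wpM2l; last by rewrite ler_nat.
  by rewrite mulr_ge0 ?normr_ge0.
have m2 : m <= 2^-1.
  apply: (le_trans mr); rewrite lef_pV2 ?posrE ?mulr_gt0//.
  have : 1 <= d.+1%:R :> R by rewrite ler1n.
  lra.
have mW : m ^+ 2 <= sqdist (const_mx 1) x.
  have h : m <= Num.sqrt (sqdist (const_mx 1) x).
    by apply: norm_le_sqdist; rewrite ?sqrtr_ge0// sqr_sqrtr ?sqdist_ge0.
  rewrite -[leRHS]sqr_sqrtr ?sqdist_ge0// ler_pXn2r ?nnegrE ?sqrtr_ge0 ?normr_ge0//.
have hk k : (x 0 k - 1) * flow_field x 0 k <= - (x 0 k - 1) ^+ 2 + 20 * m ^+ 3.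
  have xk := coord_ball k (lexx m).
  have : `|flow_field x 0 k + (x 0 k - 1)| <= 20 * m ^+ 2.
    have -> : flow_field x 0 k + (x 0 k - 1) = 2^-1 * \sum_i \sum_j A i j k *
       (flow_term (x 0 i) (x 0 j) (x 0 k) - 2 + 2 * (x 0 k - 1)).
      rewrite flow_fieldE -[X in _ + X = _](mulKf (_ : 2 != 0 :> R))// -mulrDr.
      congr (_ * _); rewrite -[X in _ + X = _](avgE k) -big_split.
      apply: eq_bigr => i _; rewrite -big_split; apply: eq_bigr => j _ /=.
      by rewrite -mulrDr.
    rewrite normrM ger0_norm ?invr_ge0//.
    have -> : 20 * m ^+ 2 = 2^-1 * (40 * m ^+ 2) by field.
    rewrite ler_wpM2l ?invr_ge0//; apply: avg_le => i j.
    by apply: flow_term_linearization => //; exact: coord_ball (lexx m).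
  move=> h.
  have : `|(x 0 k - 1) * (flow_field x 0 k + (x 0 k - 1))| <= m * (20 * m ^+ 2).
    by rewrite normrM ler_pM.
  by rewrite ler_norml => /andP[_]; rewrite mulrDr; lra.
under eq_bigr do rewrite [const_mx _ _ _]mxE.
apply: (@le_trans _ _ (2 * (- sqdist (const_mx 1) x + d%:R * (20 * m ^+ 3)))).
  rewrite ler_pM2l//; apply: (le_trans (ler_sum _ (fun k _ => hk k))).
  rewrite big_split/= sumrN sumr_const card_ord [d%:R * _]mulr_natl.
  by rewrite lerD2r lerN2; apply: ler_sum => i _; rewrite mxE.
have : m ^+ 2 * (40 * m * d%:R) <= m ^+ 2 by rewrite ler_piMr ?sqr_ge0.
rewrite exprS; nra.
Qed.

End QuadraticFlow.

(** * The Killing form of so(n) *)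

Section LieBracket.
Context {R : realType} {n : nat}.
Implicit Types X Y Z : 'M[R]_n.

Lemma lie_linearl (a : R) X Z Y : lie (a *: X + Z) Y = a *: lie X Y + lie Z Y.
Proof.
by rewrite /lie mulmxDl mulmxDr -scalemxAl -scalemxAr scalerBr opprD addrACA.
Qed.

Lemma lie_linearr (a : R) Y X Z : lie Y (a *: X + Z) = a *: lie Y X + lie Y Z.
Proof.
by rewrite /lie mulmxDl mulmxDr -scalemxAl -scalemxAr scalerBr opprD addrACA.
Qed.

Lemma lieZl (a : R) X Y : lie (a *: X) Y = a *: lie X Y.
Proof. by rewrite /lie -scalemxAl -scalemxAr scalerBr. Qed.

Lemma lieZr (a : R) X Y : lie X (a *: Y) = a *: lie X Y.
Proof. by rewrite /lie -scalemxAl -scalemxAr scalerBr. Qed.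

Lemma lieC X Y : lie X Y = - lie Y X.
Proof. by rewrite /lie opprB. Qed.

Lemma lie_jacobi X Y Z : lie (lie X Y) Z = lie X (lie Y Z) - lie Y (lie X Z).
Proof.
rewrite /lie !mulmxBl !mulmxBr !mulmxA !opprB.
by apply/matrixP => i j; rewrite !mxE; ring.
Qed.

Lemma lie_so X Y : X \in so R n -> Y \in so R n -> lie X Y \in so R n.
Proof.
rewrite !mem_so => /eqP hX /eqP hY.
by rewrite /lie raddfB/= !trmx_mul hX hY !mulNmx !mulmxN !opprK opprB.
Qed.

(** [killing] is a trace in the unspecified basis [vbasis]; expanding each basis in the other moves
    it to [e]. *)
Lemma trace_on_basis (V : {vspace 'M[R]_n}) (d : nat) (e : d.-tuple 'M[R]_n)
    (h : 'M[R]_n -> 'M[R]_n) : basis_of V e -> linear h ->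
  (forall X, X \in V -> h X \in V) ->
  trace_on V h = \sum_i coord e i (h e`_i).
Proof.
move=> eV hl hV.
pose hL := GRing.isLinear.Build _ _ _ _ h hl.
pose H : {linear 'M[R]_n -> 'M[R]_n} := HB.pack h hL.
have bV := vbasisP V; set b := vbasis V in bV *.
rewrite /trace_on -/b.
transitivity (\sum_(i < \dim V) \sum_j coord e j b`_i * coord b i (h e`_j)).
  apply: eq_bigr => i _.
  have bi : b`_i \in V by apply: (basis_mem bV); rewrite mem_nth// size_tuple.
  rewrite [in LHS](coord_basis eV bi).
  rewrite -[h]/(H : _ -> _) linear_sum linear_sum; apply: eq_bigr => j _.
  by rewrite !linearZ.
rewrite exchange_big; apply: eq_bigr => j _ /=.
have ej : e`_j \in V by apply: (basis_mem eV); rewrite mem_nth// size_tuple.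
rewrite [in RHS](coord_basis bV (hV _ ej)) linear_sum; apply: eq_bigr => i _.
by rewrite linearZ /= mulrC.
Qed.

Lemma killing_linearl (a : R) X Z Y :
  killing (a *: X + Z) Y = a * killing X Y + killing Z Y.
Proof.
rewrite /killing /trace_on mulr_sumr -big_split; apply: eq_bigr => i _ /=.
by rewrite lie_linearl linearD linearZ.
Qed.

Lemma killing_linearr (a : R) X Z Y :
  killing Y (a *: X + Z) = a * killing Y X + killing Y Z.
Proof.
rewrite /killing /trace_on mulr_sumr -big_split; apply: eq_bigr => i _ /=.
by rewrite lie_linearl lie_linearr linearD linearZ.
Qed.

Lemma gB_linearl (a : R) X Z Y : gB (a *: X + Z) Y = a * gB X Y + gB Z Y.
Proof. by rewrite /gB killing_linearl opprD mulrN. Qed.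

End LieBracket.

Section ScalarMaps.
Context {R : realType} {n : nat}.
Variable phi : 'M[R]_n -> R.
Hypothesis phi_lin : forall a X Y, phi (a *: X + Y) = a * phi X + phi Y.

Lemma scalar0 : phi 0 = 0.
Proof. by have := phi_lin (-1) 0 0; rewrite scaler0 addr0 mulN1r addNr. Qed.

Lemma scalar_sum (I : finType) (k : I -> R) (v : I -> 'M[R]_n) :
  phi (\sum_i k i *: v i) = \sum_i k i * phi (v i).
Proof.
elim/big_ind2: _ => [|X a Y b <- <-|i _]; first exact: scalar0.
  by rewrite -[X in phi (X + _)]scale1r phi_lin mul1r.
by rewrite -[X in phi X]addr0 phi_lin scalar0 addr0.
Qed.

End ScalarMaps.

(** * The adjoint representation in coordinates *)

Section AdjointMatrix.
Context {R : realType} {n d : nat}.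
Variable e : d.-tuple 'M[R]_n.
Hypothesis eb : basis_of (so R n) e.
Implicit Types X Y Z : 'M[R]_n.

Lemma basis_so (i : 'I_d) : e`_i \in so R n.
Proof. by apply: (basis_mem eb); rewrite mem_nth// size_tuple. Qed.

Lemma coord_so X : X \in so R n -> X = \sum_i coord e i X *: e`_i.
Proof. exact: coord_basis. Qed.

Lemma coord_e (i j : 'I_d) : coord e i e`_j = (i == j)%:R.
Proof. by rewrite coord_free ?(basis_free eb)// eq_sym. Qed.

Lemma linear_coord {V : lmodType R} (h : 'M[R]_n -> V) X : linear h ->
  X \in so R n -> h X = \sum_i coord e i X *: h e`_i.
Proof.
move=> hl Xso.
pose hL := GRing.isLinear.Build _ _ _ _ h hl.
pose H : {linear 'M[R]_n -> V} := HB.pack h hL.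
rewrite {1}(coord_so Xso) -[h]/(H : _ -> _) linear_sum.
by apply: eq_bigr => i _; rewrite linearZ.
Qed.

Lemma scalar_coord (phi : 'M[R]_n -> R) X :
  (forall a Y Z, phi (a *: Y + Z) = a * phi Y + phi Z) ->
  X \in so R n -> phi X = \sum_i coord e i X * phi e`_i.
Proof. by move=> phi_lin Xso; rewrite {1}(coord_so Xso) scalar_sum. Qed.

(** Row i holds the image of the i-th basis vector, the transpose of the usual matrix; hence the
    reversed products below. *)
Definition ad_mx X : 'M[R]_d := \matrix_(i, j) coord e j (lie X e`_i).

Lemma coord_lie_ad X Y j : X \in so R n -> Y \in so R n ->
  coord e j (lie X Y) = \sum_i coord e i Y * ad_mx X i j.
Proof.
move=> Xso Yso; rewrite (@linear_coord _ (lie X) _ _ Yso); last first.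
  by move=> a U V; rewrite lie_linearr.
by rewrite linear_sum; apply: eq_bigr => i _; rewrite linearZ mxE.
Qed.

Lemma killing_ad_mx X Y : X \in so R n -> Y \in so R n ->
  killing X Y = \tr (ad_mx Y *m ad_mx X).
Proof.
move=> Xso Yso; rewrite /killing (trace_on_basis eb).
- apply: eq_bigr => i _; rewrite coord_lie_ad ?lie_so ?basis_so// !mxE.
  by apply: eq_bigr => j _; rewrite !mxE.
- by move=> a U V; rewrite !lie_linearr.
- by move=> Z Zso; rewrite !lie_so.
Qed.

Lemma ad_mx_lie X Y : X \in so R n -> Y \in so R n ->
  ad_mx (lie X Y) = ad_mx Y *m ad_mx X - ad_mx X *m ad_mx Y.
Proof.
move=> Xso Yso; apply/matrixP => i j; rewrite [LHS]mxE lie_jacobi linearB /=.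
rewrite !coord_lie_ad ?lie_so ?basis_so// !mxE.
by congr (_ - _); apply: eq_bigr => k _; rewrite [in RHS]mxE.
Qed.

Lemma killingC X Y : X \in so R n -> Y \in so R n -> killing X Y = killing Y X.
Proof. by move=> Xso Yso; rewrite !killing_ad_mx// mxtrace_mulC. Qed.

(** Cyclicity of the trace, once brackets have become commutators of matrices. *)
Lemma killing_invariant X Y Z :
  X \in so R n -> Y \in so R n -> Z \in so R n ->
  killing (lie X Y) Z = killing X (lie Y Z).
Proof.
move=> Xso Yso Zso; rewrite !killing_ad_mx ?lie_so// !ad_mx_lie//.
rewrite mulmxBr mulmxBl !raddfB/= !mulmxA; congr (_ - _).
by rewrite [LHS]mxtrace_mulC mulmxA.
Qed.

End AdjointMatrix.

(** * Brackets of elementary skew matrices *)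

Section StandardBasis.
Context {R : realType} {n d : nat}.
Variable e : d.-tuple 'M[R]_n.
Implicit Types (p q r s : 'I_n).

Definition skew_unit p q : 'M[R]_n := delta_mx p q - delta_mx q p.

Lemma skew_unitN p q : skew_unit q p = - skew_unit p q.
Proof. by rewrite /skew_unit opprB. Qed.

Lemma skew_unit0 p : skew_unit p p = 0.
Proof. by rewrite /skew_unit subrr. Qed.

Lemma skew_unit_so p q : skew_unit p q \in so R n.
Proof. by rewrite mem_so /skew_unit raddfB/= !trmx_delta opprB. Qed.

(** Of the four Kronecker terms of the bracket at most one survives, because both pairs are
    increasing; if the pairs coincide two remain, but each is some [skew_unit p p = 0]. *)
Lemma lie_skew_unit p q r s : (p < q)%N -> (r < s)%N ->
  exists u v (a : R), lie (skew_unit p q) (skew_unit r s) = a *: skew_unit u v.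
Proof.
move=> pq rs.
have -> : lie (skew_unit p q) (skew_unit r s) =
    skew_unit p s *+ (q == r) - skew_unit p r *+ (q == s)
    - skew_unit q s *+ (p == r) + skew_unit q r *+ (p == s).
  rewrite /lie /skew_unit !mulmxBl !mulmxBr !mul_delta_mx_cond.
  rewrite !(eq_sym r) !(eq_sym s) !mulrnBl.
  by apply/matrixP => i j; rewrite !mxE; ring.
have lt_neq (i j : 'I_n) : (i < j)%N -> (i == j) = false.
  by move=> ij; apply/negbTE/eqP => /(congr1 val)/= h; rewrite h ltnn in ij.
have pqF := lt_neq _ _ pq; have rsF := lt_neq _ _ rs.
case qr: (q == r).
  move/eqP: qr => ?; subst r.
  have psF := lt_neq _ _ (ltn_trans pq rs).
  exists p, s, 1; rewrite rsF pqF psF.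
  by rewrite !mulr0n !subr0 addr0 mulr1n scale1r.
case qs: (q == s).
  move/eqP: qs => ?; subst s; rewrite pqF; case pr: (p == r).
    move/eqP: pr => ?; subst r; exists p, p, 0.
    by rewrite !skew_unit0 !mul0rn !mulr0n scale0r !subr0 addr0.
  by exists p, r, (-1); rewrite !mulr0n mulr1n scaleN1r subr0 addr0 sub0r.
case pr: (p == r).
  move/eqP: pr => ?; subst r; exists q, s, (-1); rewrite rsF.
  by rewrite !mulr0n !mulr1n scaleN1r subr0 addr0 sub0r.
case ps: (p == s); last first.
  by exists p, q, 0; rewrite !mulr0n scale0r !subr0 addr0.
by exists q, r, 1; rewrite !mulr0n mulr1n scale1r !subr0 add0r.
Qed.

Hypothesis he : is_standard_basis e.

Lemma standard_basis_orthonormal (i j : 'I_d) : gB e`_i e`_j = (i == j)%:R.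
Proof. by case: he. Qed.

Lemma standard_basis_skew : exists2 a : R, a != 0 \/ d = 0%N &
  (forall i : 'I_d, exists p q, (p < q)%N /\ e`_i = a *: skew_unit p q) /\
  (forall p q, (p < q)%N -> exists i : 'I_d, e`_i = a *: skew_unit p q).
Proof.
case: he => [[a /perm_mem ea] e1]; exists a.
  have [d0|d0] := posnP d; [by right|left].
  apply/eqP => a0; have := e1 (Ordinal d0) (Ordinal d0).
  have : e`_(Ordinal d0) \in e by rewrite mem_nth// size_tuple.
  rewrite ea => /mapP[pq _ ->]; rewrite a0 scale0r eqxx.
  move=> /eqP; rewrite /gB /killing /trace_on big1 ?oppr0 1?eq_sym ?oner_eq0//.
  by move=> i _; rewrite /lie !mul0mx !mulmx0 subrr linear0.
split=> [i|p q pq].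
  have : e`_i \in e by rewrite mem_nth// size_tuple.
  rewrite ea => /mapP[[p q]]; rewrite mem_enum => pq ->; by exists p, q.
have : a *: skew_unit p q \in e.
  by rewrite ea; apply/mapP; exists (p, q) => //; rewrite mem_enum.
by move=> /(nthP 0)[i]; rewrite size_tuple => id <-; exists (Ordinal id).
Qed.

(** The index [i] shows that ['I_d] is inhabited: this makes the common scale nonzero, and gives an
    index to return when p = q. *)
Lemma skew_unit_multiple (i : 'I_d) p q :
  exists (m : 'I_d) (b : R), skew_unit p q = b *: e`_m.
Proof.
have [a a0 [_ e2]] := standard_basis_skew.
have {}a0 : a != 0 by case: a0 => // d0; case: i => i; rewrite d0.
have main (p' q' : 'I_n) : (p' < q')%N ->
    exists (m : 'I_d) (b : R), skew_unit p' q' = b *: e`_m.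
  move=> /e2[m em]; exists m, a^-1.
  by rewrite em scalerA mulVf// scale1r.
case: (ltngtP p q) => [/main//|/main[m [b mb]]|/val_inj ->].
- by exists m, (- b); rewrite skew_unitN mb scaleNr.
- by exists i, 0; rewrite skew_unit0 scale0r.
Qed.

(** Orthonormality gives freeness. A skew matrix is half the sum of [X p q *: skew_unit p q] over
    all ordered pairs, which gives generation. *)
Lemma standard_basis_of : basis_of (so R n) e.
Proof.
have [a a0 [e1 e2]] := standard_basis_skew.
apply/andP; split; last first.
  apply/freeP => k ke i.
  have gBi (b : R) X Z : gB (b *: X + Z) e`_i = b * gB X e`_i + gB Z e`_i.
    exact: gB_linearl.
  have := scalar_sum gBi k (fun j => e`_j).
  rewrite ke (scalar0 gBi) (bigD1 i)//= standard_basis_orthonormal eqxx mulr1.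
  rewrite big1 ?addr0// => j ji.
  by rewrite standard_basis_orthonormal (negbTE ji) mulr0.
apply/eqP/vspaceP => X; apply/idP/idP => [|Xso].
  apply/subvP: X; apply/span_subvP => X /(nthP 0)[i].
  rewrite size_tuple => id <-.
  have [p [q [_ ->]]] := e1 (Ordinal id).
  by rewrite memvZ// skew_unit_so.
have -> : X = 2^-1 *: \sum_p \sum_q X p q *: skew_unit p q.
  rewrite /skew_unit; under eq_bigr do under eq_bigr do rewrite scalerBr.
  under eq_bigr do rewrite sumrB.
  rewrite sumrB -matrix_sum_delta exchange_big/=.
  have -> : \sum_q \sum_p X p q *: delta_mx q p = X^T.
    rewrite [RHS]matrix_sum_delta; apply: eq_bigr => q _; apply: eq_bigr => p _.
    by rewrite mxE.
  by move: Xso; rewrite mem_so => /eqP ->;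
  rewrite opprK -mulr2n -[X *+ 2]scaler_nat scalerA mulVf ?scale1r// pnatr_eq0.
rewrite memvZ// memv_suml// => p _; rewrite memv_suml// => q _; rewrite memvZ//.
have n0 : (0 < d)%N \/ p = q.
  have main (p' q' : 'I_n) : (p' < q')%N -> (0 < d)%N.
    by move=> /e2[[m md] _]; exact: leq_ltn_trans md.
  by case: (ltngtP p q) => [/main|/main|/val_inj ->]; by [left|right].
case: n0 => [d0|->]; last by rewrite skew_unit0 mem0v.
have [m [b ->]] := skew_unit_multiple (Ordinal d0) p q.
by rewrite memvZ// memv_span// mem_nth// size_tuple.
Qed.

Lemma struct_const_single (i j k l : 'I_d) : k != l ->
  struct_const e i j k * struct_const e i j l = 0.
Proof.
move=> kl; have [a _ [e1 _]] := standard_basis_skew.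
have [p [q [pq ei]]] := e1 i; have [r [s [rs ej]]] := e1 j.
have [u [v [b h]]] := lie_skew_unit pq rs.
have [m [b' h']] := skew_unit_multiple i u v.
have [t et] : exists t : R, lie e`_i e`_j = t *: e`_m.
  exists (a * (a * (b * b'))).
  by rewrite ei ej lieZl lieZr h h' !scalerA !mulrA.
have gBm (z : 'I_d) : struct_const e i j z = t * (m == z)%:R.
  rewrite /struct_const et -standard_basis_orthonormal.
  have := gB_linearl t e`_m 0 e`_z; rewrite addr0 => ->.
  have gBi (c : R) X Z : gB (c *: X + Z) e`_z = c * gB X e`_z + gB Z e`_z.
    exact: gB_linearl.
  by rewrite (scalar0 gBi) addr0.
rewrite !gBm; have [->|mk] := eqVneq m k; last by rewrite mulr0 mul0r.
by rewrite (negbTE kl) !mulr0.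
Qed.

End StandardBasis.

(** * Curvature of diagonal metrics *)

Section StructureConstants.
Context {R : realType} {n d : nat}.
Variable e : d.-tuple 'M[R]_n.
Hypothesis he : is_standard_basis e.
Implicit Types (X Y Z : 'M[R]_n) (i j k l : 'I_d).

Let eb : basis_of (so R n) e := standard_basis_of he.
Let e_so := basis_so eb.
Local Notation c := (struct_const e).

Lemma gB_coord X k : X \in so R n -> gB X e`_k = coord e k X.
Proof.
move=> Xso.
rewrite (scalar_coord (phi := fun X => gB X e`_k) eb _ Xso); last first.
  by move=> a Y Z; exact: gB_linearl.
rewrite (bigD1 k)//= standard_basis_orthonormal// eqxx mulr1 big1 ?addr0//.
by move=> i ik; rewrite standard_basis_orthonormal// (negbTE ik) mulr0.
Qed.

Lemma coord_lie_basis i j k : coord e k (lie e`_i e`_j) = c i j k.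
Proof. by rewrite -gB_coord// lie_so. Qed.

Lemma struct_constN i j k : c j i k = - c i j k.
Proof. by rewrite -!coord_lie_basis lieC linearN. Qed.

Lemma struct_const_rot i j k : c i j k = c j k i.
Proof.
rewrite /struct_const /gB (killing_invariant eb)//.
by rewrite (killingC eb) ?lie_so.
Qed.

Lemma struct_const_same i j : c i j i = 0.
Proof.
by have := struct_constN i i j; rewrite struct_const_rot; lra.
Qed.

Lemma sum_struct_const_sqr k : \sum_i \sum_j c i j k ^+ 2 = 1.
Proof.
transitivity (gB e`_k e`_k); last by rewrite standard_basis_orthonormal// eqxx.
rewrite /gB (killing_ad_mx eb)// -sumrN; apply: eq_bigr => i _.
rewrite mxE -sumrN; apply: eq_bigr => j _.
rewrite !mxE !coord_lie_basis -mulrN -struct_constN.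
by rewrite [c k i j]struct_const_rot -[c j k i]struct_const_rot expr2.
Qed.

End StructureConstants.

(** * Ricci tensor, square and codifferential of the Cartan form *)

Section DiagonalGeometry.
Context {R : realType} {n d : nat}.
Variables (e : d.-tuple 'M[R]_n) (he : is_standard_basis e).
Variables (x : 'rV[R]_d) (x0 : positive_orthant x).
Variables (f : d.-tuple 'M[R]_n) (hf : orthonormal_frame (diag_metric e x) f).
Implicit Types (X Y Z : 'M[R]_n) (i j k l : 'I_d).

Let eb : basis_of (so R n) e := standard_basis_of he.
Let e_so := basis_so eb.
Let f_so i : f`_i \in so R n. Proof. by case: hf. Qed.
Local Notation c := (struct_const e).
Local Notation g := (diag_metric e x).
Let xi0 i : 0 < x 0 i. Proof. exact: x0. Qed.
Let xi_neq0 i : x 0 i != 0. Proof. by rewrite gt_eqF. Qed.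

Lemma diag_metricC X Y : g X Y = g Y X.
Proof. by apply: eq_bigr => i _; rewrite mulrAC. Qed.

Lemma diag_metric_linearl (a : R) X Z Y : g (a *: X + Z) Y = a * g X Y + g Z Y.
Proof.
rewrite /diag_metric mulr_sumr -big_split; apply: eq_bigr => i _ /=.
by rewrite linearD linearZ /=; ring.
Qed.

Lemma diag_metric_linearr (a : R) Y X Z : g Y (a *: X + Z) = a * g Y X + g Y Z.
Proof. by rewrite !(diag_metricC Y) diag_metric_linearl. Qed.

Lemma diag_metric_basis X l : g X e`_l = x 0 l * coord e l X.
Proof.
rewrite /diag_metric (bigD1 l)//= coord_e// eqxx mulr1 big1 ?addr0// => i il.
by rewrite coord_e// (negbTE il) mulr0.
Qed.

(** Orthonormality of [f] reads [A *m D = 1] for square matrices, so [D *m A = 1] too: the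
    completeness relation of the frame. *)
Lemma frame_dual i j :
  \sum_(k < d) coord e i f`_k * coord e j f`_k = (i == j)%:R / x 0 i.
Proof.
pose A : 'M[R]_d := \matrix_(k, i) coord e i f`_k.
pose D : 'M[R]_d := \matrix_(i, k) (x 0 i * A k i).
have AD : A *m D = 1%:M.
  apply/matrixP => k l; rewrite !mxE -hf.2; apply: eq_bigr => m _.
  by rewrite !mxE mulrCA mulrA.
have /matrixP/(_ i j) := mulmx1C AD; rewrite !mxE => <-.
rewrite mulr_suml; apply: eq_bigr => k _; rewrite !mxE.
by field.
Qed.

(** The trace of a bilinear form with respect to g does not depend on the frame; the right side is
    its value in the frame of the [e l] divided by the square roots of [x l]. *)
Lemma frame_trace (T : 'M[R]_n -> 'M[R]_n -> R) :
  (forall a X Y Z, T (a *: X + Z) Y = a * T X Y + T Z Y) ->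
  (forall a X Y Z, T Y (a *: X + Z) = a * T Y X + T Y Z) ->
  \sum_(k < d) T f`_k f`_k = \sum_(l < d) T e`_l e`_l / x 0 l.
Proof.
move=> Tl Tr.
transitivity (\sum_(k < d) \sum_(i < d) \sum_(j < d)
    coord e i f`_k * coord e j f`_k * T e`_i e`_j).
  apply: eq_bigr => k _.
  rewrite (scalar_coord (phi := fun X => T X f`_k) eb)//; apply: eq_bigr => i _.
  rewrite (scalar_coord (phi := T e`_i) eb)// mulr_sumr; apply: eq_bigr => j _.
  by rewrite mulrA.
rewrite exchange_big; apply: eq_bigr => i _ /=.
rewrite exchange_big (bigD1 i)//= -mulr_suml frame_dual eqxx mul1r mulrC.
rewrite big1 ?addr0// => j ji.
by rewrite -mulr_suml frame_dual eq_sym (negbTE ji) !mul0r.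
Qed.

(** Koszul's formula in the basis [e], after total antisymmetry has reduced its three structure
    constants to one. *)
Definition christoffel i j k : R := c i j k * (x 0 k - x 0 i + x 0 j) / (2 * x 0 k).
Local Notation G := christoffel.
Local Notation nabla := (nabla g f).

Lemma nabla_so X Y : nabla X Y \in so R n.
Proof. by rewrite memv_suml// => k _; rewrite memvZ. Qed.

Lemma nabla_linearl (a : R) X Z Y : nabla (a *: X + Z) Y = a *: nabla X Y + nabla Z Y.
Proof.
rewrite scaler_sumr -big_split; apply: eq_bigr => k _ /=.
rewrite scalerA -scalerDl lie_linearl lie_linearr.
by rewrite !diag_metric_linearl diag_metric_linearr; congr (_ *: _); ring.
Qed.

Lemma nabla_linearr (a : R) Y X Z : nabla Y (a *: X + Z) = a *: nabla Y X + nabla Y Z.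
Proof.
rewrite scaler_sumr -big_split; apply: eq_bigr => k _ /=.
rewrite scalerA -scalerDl lie_linearl lie_linearr.
by rewrite !diag_metric_linearl diag_metric_linearr; congr (_ *: _); ring.
Qed.

Lemma coord_nabla_basis i j l : coord e l (nabla e`_i e`_j) = G i j l.
Proof.
(* A coordinate of [nabla] is the frame trace of a linear form times that coordinate, so
   [frame_trace] applies. *)
pose T Z W := 2^-1 * (g (lie e`_i e`_j) Z - g (lie e`_j Z) e`_i
  + g (lie Z e`_i) e`_j) * coord e l W.
have -> : coord e l (nabla e`_i e`_j) = \sum_(k < d) T f`_k f`_k.
  by rewrite linear_sum; apply: eq_bigr => k _; rewrite linearZ.
rewrite (frame_trace (T := T)).
- rewrite (bigD1 l)//= [T]lock big1 ?addr0 -lock => [|m ml]; last first.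
    by rewrite /T coord_e// eq_sym (negbTE ml) mulr0 mul0r.
  rewrite /T coord_e// eqxx mulr1 !diag_metric_basis !coord_lie_basis//.
  rewrite /christoffel -(struct_const_rot he i j l) (struct_const_rot he l i j).
  by field.
- by move=> a X Y Z; rewrite /T lie_linearl lie_linearr !diag_metric_linearl;
    rewrite diag_metric_linearr; ring.
- by move=> a X Y Z; rewrite /T linearD linearZ /=; ring.
Qed.

Lemma nabla_basis i j : nabla e`_i e`_j = \sum_k G i j k *: e`_k.
Proof.
rewrite (coord_so eb (nabla_so _ _)); apply: eq_bigr => k _.
by rewrite coord_nabla_basis.
Qed.

Let subDD3 (p p' q q' r r' : 'M[R]_n) :
  p + p' - (q + q') - (r + r') = (p - q - r) + (p' - q' - r').
Proof. by apply/matrixP => i j; rewrite !mxE; ring. Qed.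

Local Notation curv := (curvature g f).

Lemma curvature_linear1 (a : R) X X' Y Z :
  curv (a *: X + X') Y Z = a *: curv X Y Z + curv X' Y Z.
Proof.
by rewrite /curvature lie_linearl !nabla_linearl nabla_linearr subDD3 -!scalerBr.
Qed.

Lemma curvature_linear2 (a : R) X Y Y' Z :
  curv X (a *: Y + Y') Z = a *: curv X Y Z + curv X Y' Z.
Proof.
by rewrite /curvature lie_linearr !nabla_linearl nabla_linearr subDD3 -!scalerBr.
Qed.

Lemma curvature_linear3 (a : R) X Y Z Z' :
  curv X Y (a *: Z + Z') = a *: curv X Y Z + curv X Y Z'.
Proof.
by rewrite /curvature !nabla_linearr subDD3 -!scalerBr.
Qed.

Lemma ricci_linearl (a : R) X Y Z :
  ricci g f (a *: X + Y) Z = a * ricci g f X Z + ricci g f Y Z.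
Proof.
rewrite mulr_sumr -big_split; apply: eq_bigr => k _ /=.
by rewrite curvature_linear2 diag_metric_linearl.
Qed.

Lemma ricci_linearr (a : R) X Y Z :
  ricci g f Z (a *: X + Y) = a * ricci g f Z X + ricci g f Z Y.
Proof.
rewrite mulr_sumr -big_split; apply: eq_bigr => k _ /=.
by rewrite curvature_linear3 diag_metric_linearl.
Qed.

Lemma ricci_trace Y Z : ricci g f Y Z = \sum_(l < d) coord e l (curv e`_l Y Z).
Proof.
transitivity (\sum_(l < d) g (curv e`_l Y Z) e`_l / x 0 l); last first.
  by apply: eq_bigr => l _; rewrite diag_metric_basis mulrAC divff ?mul1r.
apply: (frame_trace (T := fun X W => g (curv X Y Z) W)) => *.
  by rewrite curvature_linear1 diag_metric_linearl.
by rewrite diag_metric_linearr.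
Qed.

Lemma coord_nablal X j l : X \in so R n ->
  coord e l (nabla X e`_j) = \sum_k coord e k X * G k j l.
Proof.
move=> Xso; rewrite (scalar_coord (phi := fun X => coord e l (nabla X e`_j)) eb)//.
  by apply: eq_bigr => k _; rewrite coord_nabla_basis.
by move=> a Y Z; rewrite nabla_linearl linearD linearZ.
Qed.

Lemma coord_nablar i X l : X \in so R n ->
  coord e l (nabla e`_i X) = \sum_k coord e k X * G i k l.
Proof.
move=> Xso; rewrite (scalar_coord (phi := fun X => coord e l (nabla e`_i X)) eb)//.
  by apply: eq_bigr => k _; rewrite coord_nabla_basis.
by move=> a Y Z; rewrite nabla_linearr linearD linearZ.
Qed.

Lemma christoffel_same1 i j : G i j i = 0.
Proof. by rewrite /christoffel struct_const_same// !mul0r. Qed.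

Lemma christoffel_same2 i k : G i i k = 0.
Proof.
rewrite /christoffel; have -> : c i i k = 0; last by rewrite !mul0r.
have := struct_constN he i i k; lra.
Qed.

Lemma ricci_basis (a b : 'I_d) : ricci g f e`_a e`_b = - (\sum_(l < d) \sum_(k < d)
  (G l b k * G a k l + c l a k * G k b l)).
Proof.
rewrite ricci_trace -sumrN; apply: eq_bigr => l _.
have coordB X Y : coord e l (X - Y) = coord e l X - coord e l Y by exact: linearB.
rewrite /curvature !coordB (coord_nablar l l (nabla_so e`_a e`_b)).
rewrite (coord_nablar a l (nabla_so e`_l e`_b)).
rewrite (coord_nablal b l (lie_so (e_so l) (e_so a))).
(* The first second-order term drops out: the derivative along [e l] of a basis vector has no [e l]
   component. *)
rewrite [X in X - _ - _]big1 => [|k _]; last by rewrite christoffel_same1 mulr0.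
rewrite sub0r -opprD; congr (- _); rewrite -big_split; apply: eq_bigr => k _ /=.
by rewrite coord_nabla_basis coord_lie_basis.
Qed.

Lemma ricci_basis_offdiag (a b : 'I_d) : a != b -> ricci g f e`_a e`_b = 0.
Proof.
move=> ab; rewrite ricci_basis big1 ?oppr0// => l _; rewrite big1// => k _.
have h : c l k b * c l k a = 0 by rewrite struct_const_single// eq_sym.
rewrite /christoffel.
have -> : c l b k = - c l k b.
  by rewrite struct_constN// (struct_const_rot he b l).
have -> : c a k l = - c l k a.
  by rewrite struct_constN// (struct_const_rot he l k a).
have -> : c l a k = - c l k a.
  by rewrite struct_constN// (struct_const_rot he a l).
have -> : c k b l = c l k b.
  by rewrite (struct_const_rot he l k b).
(* Each summand is the vanishing product [c l k b * c l k a] times this explicit rational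
   function. *)
rewrite -[RHS](mul0r ((x 0 k - x 0 l + x 0 b) / (2 * x 0 k) *
   ((x 0 l - x 0 a + x 0 k) / (2 * x 0 l)) - (x 0 l - x 0 k + x 0 b) / (2 * x 0 l))) -h.
ring.
Qed.

Local Notation A i j k := (c i j k ^+ 2).

(** The raw summand [t l k] is not symmetric in (l, k), although its weight is; averaging it with
    [t k l] cancels the terms linear in [x a] and leaves the summand of the ODE. *)
Lemma ricci_basis_diag (a : 'I_d) : -2 * ricci g f e`_a e`_a =
  - (\sum_(l < d) \sum_(k < d) A l k a)
  + 2^-1 * (\sum_(l < d) \sum_(k < d) A l k a *
        ((x 0 l ^+ 2 + x 0 k ^+ 2 - x 0 a ^+ 2) / (x 0 l * x 0 k))).
Proof.
pose t l k := A l k a * (2 * x 0 l * x 0 k - 3 * x 0 k ^+ 2 + 2 * x 0 k * x 0 a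
  + x 0 l ^+ 2 + x 0 a ^+ 2 - 2 * x 0 l * x 0 a) / (4 * x 0 l * x 0 k).
have rt : ricci g f e`_a e`_a = \sum_(l < d) \sum_(k < d) t l k.
  rewrite ricci_basis -sumrN; apply: eq_bigr => l _;
  rewrite -sumrN; apply: eq_bigr => k _.
  rewrite /christoffel /t.
  have -> : c l a k = - c l k a.
    by rewrite struct_constN// (struct_const_rot he a l).
  have -> : c a k l = - c l k a.
    by rewrite struct_constN// (struct_const_rot he l k a).
  have -> : c k a l = c l k a.
    by rewrite (struct_const_rot he l k a).
  by field; rewrite !xi_neq0.
have tsym : \sum_(l < d) \sum_(k < d) t l k = \sum_(l < d) \sum_(k < d) t k l.
  by rewrite exchange_big.
have -> : -2 * ricci g f e`_a e`_a = - \sum_(l < d) \sum_(k < d) (t l k + t k l).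
  under eq_bigr do rewrite big_split/=.
  by rewrite big_split/= -tsym -rt; ring.
rewrite mulr_sumr -!sumrN -big_split; apply: eq_bigr => l _ /=.
rewrite mulr_sumr -!sumrN -big_split; apply: eq_bigr => k _ /=.
rewrite /t (struct_constN he l k a).
by field; rewrite !xi_neq0.
Qed.

Local Notation H := (@cartan_form R n).

Lemma cartan_form_linear1 (a : R) X X' Y Z :
  H (a *: X + X') Y Z = a * H X Y Z + H X' Y Z.
Proof. by rewrite /cartan_form lie_linearl killing_linearl. Qed.

Lemma cartan_form_linear2 (a : R) X Y Y' Z :
  H X (a *: Y + Y') Z = a * H X Y Z + H X Y' Z.
Proof. by rewrite /cartan_form lie_linearr killing_linearl. Qed.

Lemma cartan_form_linear3 (a : R) X Y Z Z' :
  H X Y (a *: Z + Z') = a * H X Y Z + H X Y Z'.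
Proof. by rewrite /cartan_form killing_linearr. Qed.

Lemma form_square_trace X Y : form_square f H X Y =
  \sum_(i < d) \sum_(j < d) H X e`_i e`_j * H Y e`_i e`_j / (x 0 i * x 0 j).
Proof.
transitivity (\sum_(i < d) \sum_(j < d) H X f`_i e`_j * H Y f`_i e`_j / x 0 j).
  apply: eq_bigr => i _.
  have Tl a U V W : H X f`_i (a *: U + W) * H Y f`_i V =
      a * (H X f`_i U * H Y f`_i V) + H X f`_i W * H Y f`_i V.
    by rewrite cartan_form_linear3; ring.
  have Tr a U V W : H X f`_i V * H Y f`_i (a *: U + W) =
      a * (H X f`_i V * H Y f`_i U) + H X f`_i V * H Y f`_i W.
    by rewrite cartan_form_linear3; ring.
  exact: (frame_trace (T := fun U V => H X f`_i U * H Y f`_i V) Tl Tr).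
rewrite exchange_big [RHS]exchange_big; apply: eq_bigr => j _ /=.
rewrite -mulr_suml.
have Tl a U V W : H X (a *: U + W) e`_j * H Y V e`_j =
    a * (H X U e`_j * H Y V e`_j) + H X W e`_j * H Y V e`_j.
  by rewrite cartan_form_linear2; ring.
have Tr a U V W : H X V e`_j * H Y (a *: U + W) e`_j =
    a * (H X V e`_j * H Y U e`_j) + H X V e`_j * H Y W e`_j.
  by rewrite cartan_form_linear2; ring.
rewrite (frame_trace (T := fun U V => H X U e`_j * H Y V e`_j) Tl Tr) mulr_suml.
by apply: eq_bigr => i _; rewrite invfM mulrA.
Qed.

Lemma cartan_form_basis3 i j k : H e`_i e`_j e`_k = - c i j k.
Proof. by rewrite /struct_const /gB opprK. Qed.

Lemma form_square_basis (a b : 'I_d) : form_square f H e`_a e`_b =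
  (a == b)%:R * \sum_(i < d) \sum_(j < d) A i j a / (x 0 i * x 0 j).
Proof.
rewrite form_square_trace mulr_sumr; apply: eq_bigr => i _.
rewrite mulr_sumr; apply: eq_bigr => j _.
rewrite !cartan_form_basis3 mulrNN !(struct_const_rot he _ i j) mulrA; congr (_ / _).
have [->|ab] := eqVneq a b; first by rewrite mul1r expr2.
by rewrite struct_const_single// mul0r.
Qed.

Lemma form_square_linearl (a : R) X Y Z :
  form_square f H (a *: X + Y) Z = a * form_square f H X Z + form_square f H Y Z.
Proof.
rewrite !form_square_trace mulr_sumr -big_split; apply: eq_bigr => i _ /=.
rewrite mulr_sumr -big_split; apply: eq_bigr => j _ /=.
by rewrite cartan_form_linear1; ring.
Qed.

Lemma form_squareC X Y : form_square f H X Y = form_square f H Y X.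
Proof. by apply: eq_bigr => i _; apply: eq_bigr => j _; rewrite mulrC. Qed.

(** Bilinearity reduces this to basis vectors; the vanishing off the diagonal is what keeps a
    diagonal metric diagonal. *)
Lemma flow_rhs X Y : X \in so R n -> Y \in so R n ->
  - 2 * ricci g f X Y + 2^-1 * form_square f H X Y =
  \sum_k grf_field e x 0 k * coord e k X * coord e k Y.
Proof.
move=> Xso Yso; pose Q U V := - 2 * ricci g f U V + 2^-1 * form_square f H U V.
have alg (a p q r s : R) : - 2 * (a * p + q) + 2^-1 * (a * r + s) =
    a * (- 2 * p + 2^-1 * r) + (- 2 * q + 2^-1 * s) by ring.
have Ql a U V W : Q (a *: U + V) W = a * Q U W + Q V W.
  by rewrite /Q ricci_linearl form_square_linearl alg.
have Qr a U V W : Q W (a *: U + V) = a * Q W U + Q W V.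
  by rewrite /Q ricci_linearr !(form_squareC W) form_square_linearl alg.
have Qb (a b : 'I_d) : Q e`_a e`_b = (a == b)%:R * grf_field e x 0 a.
  rewrite /Q form_square_basis; have [<-|ab] := eqVneq a b.
    by rewrite ricci_basis_diag mxE !mul1r.
  by rewrite ricci_basis_offdiag// !mul0r !mulr0 addr0.
rewrite -/(Q X Y) (scalar_coord (phi := Q^~ Y) eb)//; apply: eq_bigr => k _.
rewrite (scalar_coord (phi := Q e`_k) eb)// (bigD1 k)//= Qb eqxx mul1r.
rewrite big1 ?addr0 => [|l lk]; last by rewrite Qb eq_sym (negbTE lk) mul0r mulr0.
by rewrite [coord e k Y * _]mulrC mulrCA mulrA.
Qed.

Lemma codiff_trace X Y : codiff g f H X Y = \sum_(l < d)
  (H (nabla e`_l e`_l) X Y + H e`_l (nabla e`_l X) Y + H e`_l X (nabla e`_l Y)) / x 0 l.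
Proof.
pose T U V := H (nabla U V) X Y + H U (nabla V X) Y + H U X (nabla V Y).
apply: (frame_trace (T := T)); rewrite /T => a U V W.
all: have := (nabla_linearl, nabla_linearr, cartan_form_linear1,
  cartan_form_linear2, cartan_form_linear3).
all: move: (nabla) H => N K [[[[Nl Nr] K1] K2] K3].
  by rewrite Nl !K1; ring.
by rewrite Nr !Nl K1 K2 K3; ring.
Qed.

Lemma codiff_linearl (a : R) X Y Z :
  codiff g f H (a *: X + Y) Z = a * codiff g f H X Z + codiff g f H Y Z.
Proof.
rewrite !codiff_trace mulr_sumr -big_split; apply: eq_bigr => l _ /=.
have := (nabla_linearr, cartan_form_linear2).
by move: (nabla) H => N K [Nr K2]; rewrite Nr !K2; ring.
Qed.

Lemma codiff_linearr (a : R) X Y Z :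
  codiff g f H Z (a *: X + Y) = a * codiff g f H Z X + codiff g f H Z Y.
Proof.
rewrite !codiff_trace mulr_sumr -big_split; apply: eq_bigr => l _ /=.
have := (nabla_linearr, cartan_form_linear3).
by move: (nabla) H => N K [Nr K3]; rewrite Nr !K3; ring.
Qed.

(** Each summand is [c l k a * c l k b] times the difference of one expression at a and at b: the
    product vanishes if a != b, the difference if a = b. *)
Lemma codiff_basis (a b : 'I_d) : codiff g f H e`_a e`_b = 0.
Proof.
rewrite codiff_trace big1// => l _.
have -> : nabla e`_l e`_l = 0.
  by rewrite nabla_basis big1// => k _; rewrite christoffel_same2 scale0r.
rewrite (scalar0 (phi := fun U => H U e`_a e`_b)); last first.
  by move=> *; exact: cartan_form_linear1.
have h2 : H e`_l (nabla e`_l e`_a) e`_b = \sum_(k < d) G l a k * - c l k b.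
  rewrite (scalar_coord (phi := fun U => H e`_l U e`_b) eb) ?nabla_so//.
    by apply: eq_bigr => k _; rewrite coord_nabla_basis cartan_form_basis3.
  by move=> *; exact: cartan_form_linear2.
have h3 : H e`_l e`_a (nabla e`_l e`_b) = \sum_(k < d) G l b k * - c l a k.
  rewrite (scalar_coord (phi := fun U => H e`_l e`_a U) eb) ?nabla_so//.
    by apply: eq_bigr => k _; rewrite coord_nabla_basis cartan_form_basis3.
  by move=> *; exact: cartan_form_linear3.
rewrite h2 h3 add0r -big_split/= big1 ?mul0r// => k _; rewrite /christoffel.
have la : c l a k = - c l k a.
  by rewrite struct_constN// (struct_const_rot he a l).
have lb : c l b k = - c l k b.
  by rewrite struct_constN// (struct_const_rot he b l).
rewrite la lb; have [->|ab] := eqVneq a b; first by ring.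
have h : c l k a * c l k b = 0 by rewrite struct_const_single.
rewrite -[RHS](mul0r ((x 0 k - x 0 l + x 0 a) / (2 * x 0 k)
   - (x 0 k - x 0 l + x 0 b) / (2 * x 0 k))) -h.
ring.
Qed.

Lemma codiff_eq0 X Y : X \in so R n -> Y \in so R n -> codiff g f H X Y = 0.
Proof.
move=> Xso Yso; rewrite (scalar_coord (phi := fun U => codiff g f H U Y) eb)//.
  rewrite big1// => a _; rewrite (scalar_coord (phi := codiff g f H e`_a) eb)//.
    by rewrite big1 ?mulr0// => b _; rewrite codiff_basis mulr0.
  by move=> *; exact: codiff_linearr.
by move=> *; exact: codiff_linearl.
Qed.

End DiagonalGeometry.

(** * Conclusion *)

Section KillingMetric.
Context {R : realType} {n d : nat}.
Variables (e : d.-tuple 'M[R]_n) (he : is_standard_basis e).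
Let eb : basis_of (so R n) e := standard_basis_of he.

Lemma diag_metric1 X Y : X \in so R n -> Y \in so R n ->
  diag_metric e (const_mx 1) X Y = gB X Y.
Proof.
move=> Xso Yso; rewrite (scalar_coord (phi := fun U => gB U Y) eb)//; last first.
  by move=> *; exact: gB_linearl.
apply: eq_bigr => i _; rewrite mxE mul1r; congr (_ * _).
by rewrite /gB (killingC eb) ?basis_so// -gB_coord.
Qed.

Lemma is_derive_diag_metric (x : R -> 'rV[R]_d) (t : R) v X Y :
  is_derive t 1 x v ->
  is_derive t 1 (fun s => diag_metric e (x s) X Y)
    (\sum_k v 0 k * coord e k X * coord e k Y).
Proof.
move=> /is_derive_rowP dx.
have h i := is_deriveZ (coord e i X * coord e i Y) (dx i).
have -> : (fun s => diag_metric e (x s) X Y) =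
    \sum_i (coord e i X * coord e i Y) *: (fun s => x s 0 i).
  apply/funext => s; rewrite fct_sumE; apply: eq_bigr => i _.
  by rewrite /GRing.scale/= -mulrA mulrC.
apply: (is_derive_eq (is_derive_sum h)); apply: eq_bigr => i _.
by rewrite /GRing.scale/= -mulrA mulrC.
Qed.

Lemma diag_flowP (x : R -> 'rV[R]_d) (t : R) (f : d.-tuple 'M[R]_n) :
  positive_orthant (x t) -> orthonormal_frame (diag_metric e (x t)) f ->
  is_derive t 1 x (grf_field e (x t)) <->
  generalized_ricci_flow_at (fun s => diag_metric e (x s))
    (fun=> @cartan_form R n) t f.
Proof.
move=> xt hf; split=> [dx|[dg _]].
  split=> [X Y Xso Yso|X Y Z Xso Yso Zso].
    by rewrite (flow_rhs he xt hf)//; exact: is_derive_diag_metric.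
  rewrite /ext_deriv !(codiff_eq0 he xt hf) ?lie_so// oppr0 !addr0 oppr0.
  exact: is_derive_cst.
(* Conversely, the metric equation at the pair ([e k], [e k]) is the k-th component of the ODE. *)
apply/is_derive_rowP => k.
have ek : e`_k \in so R n by exact: basis_so.
have := dg _ _ ek ek; rewrite (flow_rhs he xt hf)//.
have -> : (fun s => diag_metric e (x s) e`_k e`_k) = (fun s => x s 0 k).
  by apply/funext => s; rewrite diag_metric_basis// coord_e// eqxx mulr1.
rewrite (bigD1 k)//= coord_e// eqxx !mulr1 big1 ?addr0// => i ik.
by rewrite coord_e// (negbTE ik) mulr0.
Qed.

End KillingMetric.

Lemma flow_field_stable {R : realType} {d : nat} (A : 'I_d -> 'I_d -> 'I_d -> R) :
  (forall i j k, 0 <= A i j k) -> (forall k, \sum_i \sum_j A i j k = 1) ->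
  equilibrium (flow_field A) (@positive_orthant R d) (const_mx 1) /\
  asymptotically_stable (flow_field A) (@positive_orthant R d) (const_mx 1).
Proof.
move=> A0 A1; split.
  split=> [i|]; first by rewrite mxE.
  apply/rowP => k; rewrite flow_fieldE !mxE big1 ?mulr0// => i _.
  rewrite big1// => j _; rewrite !mxE /flow_term.
  have -> : (1 ^+ 2 + 1 ^+ 2 - 1 ^+ 2) / (1 * 1) + (1 * 1)^-1 - 2 = 0 :> R by field.
  by rewrite mulr0.
(* The radius of [flow_field_dissipative]; being at most 1/2, it also secures positivity and the
   Lipschitz bound. *)
pose r : R := (40 * d.+1%:R)^-1.
have r0 : 0 < r by rewrite invr_gt0 mulr_gt0// ltr0n.
have r2 : r <= 2^-1.
  rewrite lef_pV2 ?posrE ?mulr_gt0 ?ltr0n//.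
  have : 1 <= d.+1%:R :> R by rewrite ler1n.
  lra.
apply: (@lyapunov_asymptotically_stable R d (const_mx 1) (flow_field A) _ r 350).
- exact: r0.
- by rewrite ltr0n.
- move=> x xr i; have := row_norm_coord (x - const_mx 1) i; rewrite !mxE => h.
  have := le_trans h (le_trans xr r2); rewrite ler_norml => /andP[]; lra.
- by move=> x y xr yr; apply: flow_field_lipschitz => //; exact: le_trans r2.
- by move=> x xr; exact: flow_field_dissipative.
Qed.

Theorem theorem5p2 (R : realType) (n d : nat) (hn : (3 <= n)%N)
    (hd : d = ((n * (n - 1)) %/ 2)%N)
    (e : d.-tuple 'M[R]_n) (he : is_standard_basis e) :
  (* the point (1,...,1) is the Killing metric *)
  (forall X Y, X \in so R n -> Y \in so R n ->
     diag_metric e (const_mx 1) X Y = gB X Y) /\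
  (* the system is the generalized Ricci flow for the pairs (g(t), H_B) *)
  (forall (x : R -> 'rV[R]_d) (t : R), positive_orthant (x t) ->
     forall f : d.-tuple 'M[R]_n, orthonormal_frame (diag_metric e (x t)) f ->
     (is_derive t 1 x (grf_field e (x t)) <->
      generalized_ricci_flow_at (fun s => diag_metric e (x s))
        (fun=> @cartan_form R n) t f)) /\
  equilibrium (grf_field e) (@positive_orthant R d) (const_mx 1) /\
  asymptotically_stable (grf_field e) (@positive_orthant R d) (const_mx 1).
Proof.
split; first by move=> X Y; exact: diag_metric1.
split; first by move=> x t xt f hf; exact: diag_flowP.
apply: (@flow_field_stable R d (fun i j k => struct_const e i j k ^+ 2)).
  by move=> i j k; exact: sqr_ge0.
exact: sum_struct_const_sqr.
Qed.
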